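(* Let $w\in L^1([-1,1])$, $w\ge0$, $\int_{-1}^1w\,dx=1$, with $\log(w_0)\in L^1(\rho)$, where $\rho(x)=1/(\pi\sqrt{1-x^2})$ and $w_0(x)=\pi\sqrt{1-x^2}w(x)$. Let $p_n$ be the orthonormal polynomials with respect to $w(x)\,dx$, $f_n=p_n\sqrt{w_0}$, $\Delta_n(M)=\{x\in[-1,1]:|f_n(x)|\ge M\}$ and $F_n(w)=-\int_{-1}^1\log(p_n^2(x)w_0(x))\,p_n^2(x)w(x)\,dx$. Then for every $M>\sqrt2$, $$F_n(w)=\log2-1-\int_{\Delta_n(M)}\log(f_n^2(x))\,f_n^2(x)\,\rho(x)\,dx+o(1),\qquad n\to\infty.$$
   Context: Orthonormal polynomials: $p_n$ has degree $n$, positive leading coefficient, $\int p_np_mw\,dx=\delta_{mn}$. *)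

(* Defs.v *)
From HB Require Import structures.
From mathcomp Require Import all_boot all_order all_algebra.
From mathcomp Require Import all_classical all_reals all_analysis.
Set Implicit Arguments. Unset Strict Implicit. Unset Printing Implicit Defensive.
Import Order.TTheory GRing.Theory Num.Theory.
Import numFieldNormedType.Exports.
Local Open Scope classical_set_scope.
Local Open Scope ring_scope.

Section defs.
Variable R : realType.

Definition I11 : set R := `[(-1)%R, 1%R]%classic.

Definition rho (x : R) : R := (pi * Num.sqrt (1 - x ^+ 2))^-1.

Definition w0 (w : R -> R) (x : R) : R := pi * Num.sqrt (1 - x ^+ 2) * w x.

Definition orthonormal_polys (w : R -> R) (p : nat -> {poly R}) : Prop :=
  (forall n, size (p n) = n.+1 /\ 0 < lead_coef (p n)) /\
  (forall m n, (\int[lebesgue_measure]_(x in I11)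
                   ((p n).[x] * (p m).[x] * w x)%:E)%E
               = (if m == n then 1 else 0)%:E).

Definition fn (w : R -> R) (p : nat -> {poly R}) (n : nat) (x : R) : R :=
  (p n).[x] * Num.sqrt (w0 w x).

Definition Delta (w : R -> R) (p : nat -> {poly R}) (n : nat) (M : R) : set R :=
  [set x | I11 x /\ M <= `|fn w p n x|].

Definition Fn (w : R -> R) (p : nat -> {poly R}) (n : nat) : \bar R :=
  (- \int[lebesgue_measure]_(x in I11)
       (ln ((p n).[x] ^+ 2 * w0 w x) * (p n).[x] ^+ 2 * w x)%:E)%E.

End defs.

(* Main.v *)
(** Write [z = x + i sqrt(1 - x^2)] for the point of the upper unit half-circle
    above [x], so that polynomials in [z] with real coefficients, integrated
    against [w], are those of the unit circle for the symmetric weight [w0].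

    Let [m] be the infimum of [int |A(z)|^2 w] over real polynomials with
    [A(0) = 1]. Jensen's inequality and the integrability of [ln w0] give [m > 0].
    If [A] almost attains [m] then, by the variational characterisation, [A] is
    almost orthogonal to all polynomials vanishing at [0]; two near minimizers are
    close in [L^2(w)], and the moments of [|A(z)|^2 w] are almost those of [m rho],
    so [|A(z)|^2 w] is [L^1]-close to [m rho]. The same almost-orthogonality applied to
    [z^n p_n(x)] bounds the leading coefficient of [p_n] and shows that [f_n] is
    [L^2(rho)]-close to [sqrt 2 Re (z^n conj s)] with the fixed phase [s = A(z)/|A(z)|].
    This replaces the Szego function and needs no Hardy space theory.

    On [|f| < M] with [M > sqrt 2] the truncated function [f^2 ln f^2] is Lipschitz
    relative to the values of size at most [sqrt 2], so its integral may be computed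
    with [2 (Re u)^2 = 1 + Re (u^2)], [u = z^n conj s], instead of [f_n^2]. Expanding
    [ln (1 + t^2 + 2 t c) = - 2 sum_k (-t)^k T_k(c) / k] and applying Bessel's
    inequality (Riemann-Lebesgue) the limit is [1 - ln 2] as [t] tends to [1]. *)
Require Import Defs.
From HB Require Import structures.
From mathcomp Require Import all_boot all_order all_algebra.
From mathcomp Require Import complex.
From mathcomp Require Import all_classical all_reals all_analysis.
From mathcomp Require Import measurable_realfun.
From mathcomp Require Import zify ring lra.
Set Implicit Arguments. Unset Strict Implicit. Unset Printing Implicit Defensive.
Import Order.TTheory GRing.Theory Num.Theory.
Import numFieldNormedType.Exports.
Local Open Scope classical_set_scope.
Local Open Scope ring_scope.
Local Notation Re := (@complex.Re _).
Local Notation Im := (@complex.Im _).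

(** * Integration on [-1, 1] *)

(** The obstacle is that [L^2(rho)] convergence gives no control of [f_n^2 ln f_n^2] where [f_n] is
    large. That part, possibly infinite, is kept as it stands: removing it is an exact identity in
    the extended reals for every [n], and only the truncated part needs asymptotics.

    No limit object is ever built. A near minimizer [A] of excess [d^2] gives errors of order [d],
    uniformly in [n >= size A]. At a given accuracy the phase is therefore fixed before [n] grows,
    which is what Riemann-Lebesgue needs, and [d] is chosen last in terms of the accuracy.

    The constant is a mean over the circle: as the argument of [u^2] equidistributes,
    [2 (Re u)^2 = 1 + Re (u^2)] behaves like [1 + cos phi], and the mean of
    [(1 + cos phi) ln (1 + cos phi)] is [1 - ln 2]. *)

Section integral_on_I11.
Variable R : realType.
Local Notation mu := (@lebesgue_measure R).
Local Notation I := (@I11 R).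
Implicit Types f g h : R -> R.

Definition itg f := mu.-integrable I (EFin \o f).
Definition intI f : R := \int[mu]_(x in I) f x.
Definition bmf h := measurable_fun I h /\ exists K : R, forall x, I x -> `|h x| <= K.

Lemma mI : measurable I. Proof. exact: measurable_itv. Qed.
Lemma mIL : measurable (I : set (measurableTypeR R)). Proof. exact: mI. Qed.
Hint Resolve mI mIL : core.

Lemma I11E x : I x <-> (-1 <= x <= 1).
Proof. by rewrite /I11 /= in_itv. Qed.

Lemma mu_I : mu I = 2%:E.
Proof.
rewrite lebesgue_measure_itv /= lte_fin ifT; last by rewrite gtrN.
by rewrite -EFinD opprK.
Qed.

Lemma mu_I_fin : (mu I < +oo)%E.
Proof. by rewrite mu_I ltry. Qed.

Lemma int_EFin f : itg f -> (\int[mu]_(x in I) (f x)%:E)%E = (intI f)%:E.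
Proof. by move=> fi; rewrite /intI /Rintegral fineK//; exact: integrable_fin_num. Qed.

Lemma itg_meas f : itg f -> measurable_fun I f.
Proof. by move=> /integrableP[/measurable_EFinP]. Qed.

Lemma eq_itg f g : (forall x, I x -> f x = g x) -> itg f -> itg g.
Proof.
by move=> fg; apply: eq_integrable => // x; rewrite inE => Ix /=; rewrite fg.
Qed.

Lemma eq_int f g : (forall x, I x -> f x = g x) -> intI f = intI g.
Proof. by move=> fg; apply: eq_Rintegral => x; rewrite inE => /fg. Qed.

Lemma itgD f g : itg f -> itg g -> itg (fun x => f x + g x).
Proof. move=> fi gi; have := integrableD mIL fi gi; apply: eq_integrable => // x _; exact: EFinD. Qed.

Lemma itgB f g : itg f -> itg g -> itg (fun x => f x - g x).
Proof. move=> fi gi; have := integrableB mIL fi gi; apply: eq_integrable => // x _; exact: EFinB. Qed.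

Lemma itgZ k f : itg f -> itg (fun x => k * f x).
Proof. move=> fi; have := integrableZl mIL k fi; apply: eq_integrable => // x _; exact: EFinM. Qed.

Lemma itgM h f : bmf h -> itg f -> itg (fun x => h x * f x).
Proof.
move=> [mh [K hK]] fi; 
have : [bounded h x | x in I].
  exists K; split; first by rewrite num_real.
  by move=> M KM x Ix; apply: le_trans (ltW KM); exact: hK.
move=> bh; have := integrableMr mIL mh bh fi.
by apply: eq_integrable => // x _; exact: EFinM.
Qed.

Lemma itg_le f g : measurable_fun I f -> (forall x, I x -> `|f x| <= g x) ->
  itg g -> itg f.
Proof.
move=> mf fg; apply: le_integrable => //; first exact/measurable_EFinP.
move=> x Ix /=; rewrite lee_fin; exact: le_trans (fg x Ix) (ler_norm _).
Qed.

Lemma itg_abs f : itg f -> itg (fun x => `|f x|).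
Proof. exact: integrable_norm. Qed.

Lemma itg_bmf h : bmf h -> itg h.
Proof.
move=> [mh [K hK]]; apply: measurable_bounded_integrable => //; first exact: mu_I_fin.
exists K; split; first by rewrite num_real.
by move=> M KM x Ix; apply: le_trans (ltW KM); exact: hK.
Qed.

Lemma intD f g : itg f -> itg g -> intI (fun x => f x + g x) = intI f + intI g.
Proof. exact: RintegralD. Qed.

Lemma intB f g : itg f -> itg g -> intI (fun x => f x - g x) = intI f - intI g.
Proof. exact: RintegralB. Qed.

Lemma intZ k f : itg f -> intI (fun x => k * f x) = k * intI f.
Proof. exact: RintegralZl. Qed.

Lemma le_int f g : itg f -> itg g -> (forall x, I x -> f x <= g x) -> intI f <= intI g.
Proof. exact: le_Rintegral. Qed.

Lemma int_ge0 f : (forall x, I x -> 0 <= f x) -> 0 <= intI f.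
Proof. by move=> f0; rewrite /intI /Rintegral fine_ge0// integral_ge0. Qed.

Lemma int_abs f : itg f -> `|intI f| <= intI (fun x => `|f x|).
Proof. exact: le_normr_Rintegral. Qed.

Lemma itg0 : itg (fun=> 0). Proof. exact: integrable0. Qed.

Lemma int0 : intI (fun=> 0) = 0.
Proof. by rewrite /intI /Rintegral integral0. Qed.

Lemma itg_sum (J : eqType) (s : seq J) (F : J -> R -> R) :
  (forall j, itg (F j)) -> itg (fun x => \sum_(j <- s) F j x).
Proof.
move=> Fi; elim: s => [|a s IH].
  by apply: eq_itg itg0 => x _; rewrite big_nil.
by apply: eq_itg (itgD (Fi a) IH) => x _; rewrite big_cons.
Qed.

Lemma int_sum (J : eqType) (s : seq J) (F : J -> R -> R) :
  (forall j, itg (F j)) ->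
  intI (fun x => \sum_(j <- s) F j x) = \sum_(j <- s) intI (F j).
Proof.
move=> Fi; elim: s => [|a s IH].
  by rewrite big_nil -[RHS]int0; apply: eq_int => x _; rewrite big_nil.
rewrite big_cons -IH -intD//; last exact: itg_sum.
by apply: eq_int => x _; rewrite big_cons.
Qed.

Lemma ae_ge0_int f : itg f -> {ae mu, forall x, I x -> 0 <= f x} -> 0 <= intI f.
Proof.
move=> fi f0; pose g x := Order.max (f x) 0.
have mg : measurable_fun I g by apply: measurable_maxr => //; exact: itg_meas.
have -> : intI f = intI g.
  congr fine; apply: ae_eq_integral => //.
  - by apply/measurable_EFinP; exact: itg_meas.
  - exact/measurable_EFinP.
  - move: f0; apply: (@filterS _ _ (ae_filter_ringOfSetsType mu)) => x fx0 Ix; congr EFin.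
    by rewrite /g; apply/esym/max_idPl/fx0.
by apply: int_ge0 => x _; rewrite /g le_max lexx orbT.
Qed.

Lemma bmf_meas h : bmf h -> measurable_fun I h. Proof. by case. Qed.

Lemma bmf_cst k : bmf (fun=> k).
Proof. by split; [exact: measurable_cst | exists `|k|]. Qed.

Lemma bmfD f g : bmf f -> bmf g -> bmf (fun x => f x + g x).
Proof.
move=> [mf [K fK]] [mg [L gL]]; split; first exact: measurable_funD.
exists (K + L) => x Ix; apply: le_trans (ler_normD _ _) _.
by rewrite lerD ?fK ?gL.
Qed.

Lemma bmfM f g : bmf f -> bmf g -> bmf (fun x => f x * g x).
Proof.
move=> [mf [K fK]] [mg [L gL]]; split; first exact: measurable_funM.
by exists (K * L) => x Ix; rewrite normrM ler_pM ?fK ?gL.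
Qed.

Lemma bmfN f : bmf f -> bmf (fun x => - f x).
Proof.
move=> [mf [K fK]]; split; first exact: measurableT_comp.
by exists K => x Ix; rewrite normrN fK.
Qed.

Lemma bmfB f g : bmf f -> bmf g -> bmf (fun x => f x - g x).
Proof. by move=> bf bg; apply: bmfD bf _; exact: bmfN. Qed.

Lemma bmfX f n : bmf f -> bmf (fun x => f x ^+ n).
Proof.
move=> bf; elim: n => [|n IH].
  by rewrite (_ : (fun _ => _) = (fun=> 1)); [exact: bmf_cst|apply/funext].
under eq_fun do rewrite exprS; exact: bmfM.
Qed.

Lemma bmf_id : bmf id.
Proof. by split => //; exists 1 => x /I11E /andP[? ?]; rewrite ler_norml; lra. Qed.

Lemma bmf_horner (p : {poly R}) f : bmf f -> bmf (fun x => p.[f x]).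
Proof.
move=> bf; elim/poly_ind: p => [|p c IH].
  by under eq_fun do rewrite horner0; exact: bmf_cst.
under eq_fun do rewrite hornerMXaddC; apply: bmfD (bmf_cst _); exact: bmfM.
Qed.

Lemma bmf_le1 h : measurable_fun I h -> (forall x, I x -> `|h x| <= 1) -> bmf h.
Proof. by move=> mh h1; split => //; exists 1. Qed.

End integral_on_I11.
#[export] Hint Resolve mI mIL : core.

(** * The unit half-circle above [-1, 1] *)

Section circle.
Variable R : realType.
Local Notation I := (@I11 R).
Local Notation C := (R[i]%type).

(** The squared modulus with values in [R], whereas the norm of [R[i]] takes its values in
    [R[i]]. *)
Definition nsq (z : C) : R := Re z ^+ 2 + Im z ^+ 2.

Lemma ReD (a b : C) : Re (a + b) = Re a + Re b. Proof. by case: a; case: b. Qed.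
Lemma ImD (a b : C) : Im (a + b) = Im a + Im b. Proof. by case: a; case: b. Qed.
Lemma ReN (a : C) : Re (- a) = - Re a. Proof. by case: a. Qed.
Lemma ImN (a : C) : Im (- a) = - Im a. Proof. by case: a. Qed.
Lemma ReM (a b : C) : Re (a * b) = Re a * Re b - Im a * Im b.
Proof. by case: a; case: b. Qed.
Lemma ImM (a b : C) : Im (a * b) = Re a * Im b + Im a * Re b.
Proof. by case: a => ? ?; case: b => ? ? /=; rewrite addrC. Qed.
Lemma ReJ (a : C) : Re (conjc a) = Re a. Proof. by case: a. Qed.
Lemma ImJ (a : C) : Im (conjc a) = - Im a. Proof. by case: a. Qed.
Lemma Re_real (r : R) : Re (real_complex R r) = r. Proof. by []. Qed.
Lemma Im_real (r : R) : Im (real_complex R r) = 0. Proof. by []. Qed.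

Definition ReImE := (ReD, ImD, ReN, ImN, ReM, ImM, ReJ, ImJ, Re_real, Im_real).

Lemma nsq_ge0 z : 0 <= nsq z. Proof. by rewrite addr_ge0 ?sqr_ge0. Qed.

Lemma nsqM a b : nsq (a * b) = nsq a * nsq b.
Proof. by rewrite /nsq !ReImE; ring. Qed.

Lemma nsqX a n : nsq (a ^+ n) = nsq a ^+ n.
Proof.
elim: n => [|n IH]; first by rewrite !expr0 /nsq /= expr1n expr0n addr0.
by rewrite !exprS nsqM IH.
Qed.

Lemma nsqJ a : nsq (conjc a) = nsq a.
Proof. by rewrite /nsq !ReImE sqrrN. Qed.

Lemma conjcX (a : C) n : conjc (a ^+ n) = conjc a ^+ n.
Proof. exact: rmorphXn. Qed.

Lemma conjcM (a b : C) : conjc (a * b) = conjc a * conjc b.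
Proof. exact: rmorphM. Qed.

Lemma conjcD (a b : C) : conjc (a + b) = conjc a + conjc b.
Proof. exact: rmorphD. Qed.

Lemma conjcB (a b : C) : conjc (a - b) = conjc a - conjc b.
Proof. exact: rmorphB. Qed.

Lemma nsq1 : nsq 1 = 1.
Proof. by rewrite /nsq /= expr1n expr0n addr0. Qed.

Lemma real_complex1 : real_complex R 1 = 1.
Proof. by []. Qed.

Lemma nsqN a : nsq (- a) = nsq a.
Proof. by rewrite /nsq !ReImE !sqrrN. Qed.

Lemma nsq_eq0 a : (nsq a == 0) = (a == 0).
Proof.
case: a => x y; rewrite /nsq /= paddr_eq0 ?sqr_ge0// !sqrf_eq0.
by rewrite eq_complex.
Qed.

Lemma nsq_le2 a b : nsq (a + b) <= 2 * nsq a + 2 * nsq b.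
Proof.
rewrite /nsq !ReImE.
have := sqr_ge0 (Re a - Re b); have := sqr_ge0 (Im a - Im b).
by rewrite !sqrrB !sqrrD; lra.
Qed.

Lemma mulcJE a : a * conjc a = real_complex R (nsq a).
Proof. by apply/eqP; rewrite eq_complex !ReImE /nsq; apply/andP; split; apply/eqP; ring. Qed.

Lemma sqr_Re_le a : Re a ^+ 2 <= nsq a.
Proof. by rewrite lerDl sqr_ge0. Qed.

Lemma sqr_Im_le a : Im a ^+ 2 <= nsq a.
Proof. by rewrite lerDr sqr_ge0. Qed.

Lemma normr_Re_le1 a : nsq a <= 1 -> `|Re a| <= 1.
Proof.
by move=> a1; rewrite -(@ler_pXn2r _ 2) ?nnegrE// expr1n real_normK ?num_real// (le_trans (sqr_Re_le a)).
Qed.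

Lemma normr_Im_le1 a : nsq a <= 1 -> `|Im a| <= 1.
Proof.
by move=> a1; rewrite -(@ler_pXn2r _ 2) ?nnegrE// expr1n real_normK ?num_real// (le_trans (sqr_Im_le a)).
Qed.

End circle.

Section circle_parametrization.
Variable R : realType.
Local Notation I := (@I11 R).
Local Notation C := (R[i]%type).

Definition zc (x : R) : C := Complex x (Num.sqrt (1 - x ^+ 2)).

Lemma nsq_zc x : I x -> nsq (zc x) = 1.
Proof.
move=> /I11E x1; rewrite /nsq /= sqr_sqrtr; first by rewrite subrKC.
by rewrite subr_ge0 -[X in _ <= X](expr1n _ 2) -real_normK ?num_real// lerXn2r ?nnegrE ?ler_norml.
Qed.

Definition bmc (F : R -> C) := bmf (fun x => Re (F x)) /\ bmf (fun x => Im (F x)).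

Lemma bmc_cst c : bmc (fun=> c). Proof. by split; exact: bmf_cst. Qed.

Lemma bmcD F G : bmc F -> bmc G -> bmc (fun x => F x + G x).
Proof.
move=> [F1 F2] [G1 G2]; split.
  by under eq_fun do rewrite ReD; exact: bmfD.
by under eq_fun do rewrite ImD; exact: bmfD.
Qed.

Lemma bmcM F G : bmc F -> bmc G -> bmc (fun x => F x * G x).
Proof.
move=> [F1 F2] [G1 G2]; split.
  by under eq_fun do rewrite ReM; apply: bmfB; exact: bmfM.
by under eq_fun do rewrite ImM; apply: bmfD; exact: bmfM.
Qed.

Lemma bmcJ F : bmc F -> bmc (fun x => conjc (F x)).
Proof.
move=> [F1 F2]; split.
  by under eq_fun do rewrite ReJ.
by under eq_fun do rewrite ImJ; exact: bmfN.
Qed.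

Lemma bmcX F n : bmc F -> bmc (fun x => F x ^+ n).
Proof.
move=> bF; elim: n => [|n IH].
  by rewrite (_ : (fun _ => _) = (fun=> 1)); [exact: bmc_cst|apply/funext].
under eq_fun do rewrite exprS; exact: bmcM.
Qed.

Lemma bmc_horner (p : {poly C}) F : bmc F -> bmc (fun x => p.[F x]).
Proof.
move=> bF; elim/poly_ind: p => [|p c IH].
  by under eq_fun do rewrite horner0; exact: bmc_cst.
by under eq_fun do rewrite hornerMXaddC; apply: bmcD (bmc_cst _); exact: bmcM.
Qed.

Lemma bmf_nsq F : bmc F -> bmf (fun x => nsq (F x)).
Proof. by move=> [F1 F2]; apply: bmfD; exact: bmfX. Qed.

Lemma continuous_ysqrt : continuous (fun x : R => Num.sqrt (1 - x ^+ 2)).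
Proof.
move=> x; apply: continuous_comp; last exact: sqrt_continuous.
by apply: cvgB; [exact: cvg_cst|exact: exprn_continuous].
Qed.

Lemma bmc_zc : bmc zc.
Proof.
split; first exact: bmf_id.
apply: bmf_le1 => [|x Ix]; last first.
  rewrite /= ger0_norm ?sqrtr_ge0// -[X in _ <= X]sqrtr1 ler_wsqrtr//.
  by rewrite lerBlDr lerDl sqr_ge0.
apply: measurable_funTS; apply: continuous_measurable_fun.
exact: continuous_ysqrt.
Qed.

Lemma zcS_Re k x : Re (zc x ^+ k.+1) = Re (zc x ^+ k) * x - Im (zc x ^+ k) * Num.sqrt (1 - x ^+ 2).
Proof. by rewrite exprSr ReM. Qed.

Lemma zcS_Im k x : Im (zc x ^+ k.+1) = Re (zc x ^+ k) * Num.sqrt (1 - x ^+ 2) + Im (zc x ^+ k) * x.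
Proof. by rewrite exprSr ImM. Qed.

Lemma continuous_zcX k : continuous (fun x : R => Re (zc x ^+ k)) /\ continuous (fun x : R => Im (zc x ^+ k)).
Proof.
elim: k => [|k [IH1 IH2]].
  split => x.
    by rewrite (_ : (fun _ => _) = fun=> 1); [exact: cvg_cst|apply/funext => y; rewrite expr0].
  by rewrite (_ : (fun _ => _) = fun=> 0); [exact: cvg_cst|apply/funext => y; rewrite expr0].
split => x.
  under eq_fun do rewrite zcS_Re.
  apply: cvgB; apply: cvgM; [exact: IH1|exact: cvg_id|exact: IH2|exact: continuous_ysqrt].
under eq_fun do rewrite zcS_Im.
apply: cvgD; apply: cvgM; [exact: IH1|exact: continuous_ysqrt|exact: IH2|exact: cvg_id].
Qed.

Lemma ysqrt_gt0 (x : R) : -1 < x < 1 -> 0 < Num.sqrt (1 - x ^+ 2).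
Proof.
move=> /andP[x1 x2]; rewrite sqrtr_gt0 (_ : 1 - x ^+ 2 = (1 - x) * (1 + x)); last by ring.
by rewrite mulr_gt0//; lra.
Qed.

Lemma is_derive_ysqrt (x : R) : -1 < x < 1 ->
  is_derive x (1 : R) (fun x : R => Num.sqrt (1 - x ^+ 2)) (- x / Num.sqrt (1 - x ^+ 2)).
Proof.
move=> x1; have y0 := ysqrt_gt0 x1.
have h : 0 < 1 - x ^+ 2 by rewrite -sqrtr_gt0.
have d1 : is_derive x (1 : R) (fun x : R => 1 - x ^+ 2) (- (2 * x)).
  by apply: is_derive_eq; rewrite /GRing.scale /=; ring.
have := @is_derive1_comp R Num.sqrt (fun x : R => 1 - x ^+ 2) x _ _ (is_derive1_sqrt h) d1.
move=> d2; apply: (@is_derive_eq _ _ _ _ _ _ _ _ d2).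
by field; rewrite gt_eqF.
Qed.


(** With [x = cos theta], the two parts of [z^k] are [cos (k theta)] and [sin (k theta)], and
    [d theta / dx = - 1 / sin theta]. *)
Lemma is_derive_zcX k (x : R) : -1 < x < 1 ->
  is_derive x (1 : R) (fun x => Re (zc x ^+ k)) (k%:R * Im (zc x ^+ k) / Num.sqrt (1 - x ^+ 2)) /\
  is_derive x (1 : R) (fun x => Im (zc x ^+ k)) (- (k%:R * Re (zc x ^+ k)) / Num.sqrt (1 - x ^+ 2)).
Proof.
move=> x1; have y0 := ysqrt_gt0 x1; have dy := is_derive_ysqrt x1.
elim: k => [|k [IH1 IH2]].
  split; rewrite mul0r ?oppr0 mul0r.
    by rewrite (_ : (fun _ => _) = fun=> 1); [exact: is_derive_cst|apply/funext => y; rewrite expr0].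
  by rewrite (_ : (fun _ => _) = fun=> 0); [exact: is_derive_cst|apply/funext => y; rewrite expr0].
set y := Num.sqrt _ in IH1 IH2 y0 dy *.
have yn0 : y != 0 by rewrite gt_eqF.
have y2 : y ^+ 2 = 1 - x ^+ 2.
  by rewrite sqr_sqrtr// ltW// -sqrtr_gt0.
split.
  under eq_fun do rewrite zcS_Re.
  apply: is_derive_eq.
  rewrite zcS_Im -/y /GRing.scale /= -natr1.
  by field: y2.
under eq_fun do rewrite zcS_Im.
apply: is_derive_eq.
rewrite zcS_Re -/y /GRing.scale /= -natr1.
by field.
Qed.

End circle_parametrization.

(** * Moments of the arcsine density *)

Section arcsine_moments.
Variable R : realType.
Local Notation mu := (@lebesgue_measure R).
Local Notation I := (@I11 R).

(** The intervals [[- b n, b n]] exhaust the open interval. Taking [b n] as a cosine makes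
    [acos (b n)] equal to [h n], and the shift by 2 keeps [h n] below [pi / 2], so that [b n] is
    positive from [n = 0] on. *)
Let h (n : nat) : R := (n.+2%:R)^-1.
Let b (n : nat) : R := cos (h n).

Let h_gt0 n : 0 < h n. Proof. by rewrite invr_gt0 ltr0n. Qed.

Let h_le n : h n <= 2^-1.
Proof. by rewrite lef_pV2 ?posrE ?ltr0n// ler_nat. Qed.

Let h_cvg : h @ \oo --> (0 : R).
Proof.
by have := @cvg_harmonic R; rewrite -(cvg_shiftS (@harmonic R)); exact.
Qed.

Let pi2 : 2 <= (pi : R). Proof. exact: pi_ge2. Qed.

Let h_pi n : h n \in `[0, (pi : R)].
Proof. by rewrite in_itv /= (ltW (h_gt0 n)) /=; have := h_le n; have := pi2; lra. Qed.

Let b_gt0 n : 0 < b n.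
Proof.
apply: cos_gt0_pihalf; have := h_gt0 n; have := h_le n; have := pi2 => *.
by apply/andP; split; lra.
Qed.

Let b_lt1 n : b n < 1.
Proof.
rewrite -(@cos0 R) ltr_cos ?h_gt0//.
by rewrite in_itv /= lexx (le_trans _ pi2).
Qed.

Let b_cvg : b @ \oo --> (1 : R).
Proof.
rewrite -(@cos0 R); apply: (@cvg_comp _ _ _ h cos _ (nbhs (0 : R))); first exact: h_cvg.
exact: continuous_cos.
Qed.

Let b_nd n m : (n <= m)%N -> b n <= b m.
Proof.
rewrite leq_eqVlt => /predU1P[->//|nm].
by apply/ltW; rewrite ltr_cos// ltf_pV2 ?posrE ?ltr0n// ltr_nat.
Qed.

Let F_ (n : nat) : set R := `[- b n, b n]%classic.

Let bigcup_F : \bigcup_n F_ n = `](-1)%R, 1%R[%classic.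
Proof.
apply/seteqP; split => x /=.
  move=> [n _]; rewrite /F_ /= !in_itv /= => /andP[x1 x2].
  by have := b_lt1 n => ?; apply/andP; split; lra.
rewrite in_itv /= => /andP[x1 x2].
have : \forall n \near \oo, `|x| < b n.
  have x3 : `|x| < 1 by rewrite ltr_norml x1.
  move: b_cvg => /cvgr_gt; exact.
move=> [N _ HN]; exists N => //; rewrite /F_ /= in_itv /= -ler_norml.
by apply/ltW/HN => /=.
Qed.

(** Monotone convergence along the intervals [F_ n], on each of which the usual fundamental theorem
    applies. It allows [f] to blow up at both endpoints, at the price of a sign condition. *)
Lemma ge0_FTC_I11 (f F : R -> R) (l : R) :
  measurable_fun I f -> (forall x, I x -> 0 <= f x) ->
  (forall x : R, -1 < x < 1 -> {for x, continuous f}) ->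
  (forall x : R, -1 < x < 1 -> is_derive x (1 : R) F (f x)) ->
  (fun n => F (b n) - F (- b n)) @ \oo --> l ->
  (\int[mu]_(x in I) (f x)%:E = l%:E)%E.
Proof.
move=> mf f0 cf dF Fl.
have mfo : measurable_fun (`](-1)%R, 1%R[%classic : set R) f.
  apply: (measurable_funS (@mI R)) mf; exact: subset_itv_oo_cc.
have F_I n (x : R) : F_ n x -> -1 < x < 1.
  rewrite /F_ /= in_itv /= => /andP[x1 x2].
  by have := b_lt1 n => ?; apply/andP; split; lra.
have Fb n (x : R) : - b n <= x <= b n -> -1 < x < 1.
  by move=> xb; apply: (F_I n); rewrite /F_ /= in_itv.
rewrite /I11 integral_itv_bndoo; last exact/measurable_EFinP.
rewrite -bigcup_F.
have := @ge0_nondecreasing_set_cvg_integral _ (measurableTypeR R) R F_ (EFin \o f) mu.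
move=> /(_ _ _ _ _)/cvg_lim <- //; last first.
- move=> n x /F_I /andP[x1 x2]; rewrite lee_fin f0//.
  by apply/I11E; rewrite !ltW.
- move=> n; apply/measurable_EFinP; apply: (measurable_funS _ _ mfo); first exact: measurable_itv.
  by move=> x /F_I; rewrite /= in_itv.
- by move=> n; exact: measurable_itv.
- move=> n m nm; apply/subsetPset => x; rewrite /F_ /= !in_itv /= => /andP[x1 x2].
  by have := b_nd nm => ?; apply/andP; split; lra.
apply/cvg_lim => //.
have -> : (fun i => \int[mu]_(x in F_ i) (EFin \o f) x)%E =
    (fun n => (F (b n) - F (- b n))%:E).
  apply/funext => n; rewrite (@continuous_FTC2 _ f F) ?EFinB//.
  - by have := b_gt0 n; lra.
  - apply: continuous_in_subspaceT => x; rewrite inE /= in_itv /= => /Fb; exact: cf.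
  - have dd (x : R) : -1 < x < 1 -> derivable F x 1 by move=> /dF [].
    have cc (x : R) : -1 < x < 1 -> {for x, continuous F}.
      by move=> x1; apply: differentiable_continuous; apply/derivable1_diffP/dd.
    have bn := b_gt0 n; have bn1 := b_lt1 n.
    split.
    + by move=> x; rewrite in_itv /= => /andP[x1 x2]; apply: dd; apply/andP; split; lra.
    + by apply: cvg_at_right_filter; apply: cc; apply/andP; split; lra.
    + by apply: cvg_at_left_filter; apply: cc; apply/andP; split; lra.
  - move=> x; rewrite in_itv /= => /andP[x1 x2]; rewrite derive1E.
    have [] := dF x => //; have := b_lt1 n => ?; by apply/andP; split; lra.
by apply: cvg_EFin; first exact: nearW.
Qed.

Lemma rhoE (x : R) : rho x = pi^-1 * (Num.sqrt (1 - x ^+ 2))^-1.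
Proof. by rewrite /rho invfM. Qed.

Lemma rho_ge0 (x : R) : 0 <= rho x.
Proof. by rewrite /rho invr_ge0 mulr_ge0 ?pi_ge0 ?sqrtr_ge0. Qed.

Lemma continuous_rho (x : R) : -1 < x < 1 -> {for x, continuous (@rho R)}.
Proof.
move=> x1; have y0 := ysqrt_gt0 x1.
apply: cvgV; first by rewrite gt_eqF// mulr_gt0 ?pi_gt0.
by apply: cvgMr; exact: continuous_ysqrt.
Qed.

Lemma measurable_rho : measurable_fun I (@rho R).
Proof.
apply/measurable_fun_itv_obnd_cbndP; apply/measurable_fun_itv_bndo_bndcP.
apply: open_continuous_measurable_fun; first exact: interval_open.
by move=> x; rewrite inE /= in_itv /=; exact: continuous_rho.
Qed.

Lemma integral_rho : (\int[mu]_(x in I) (rho x)%:E = 1%:E)%E.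
Proof.
apply: (@ge0_FTC_I11 _ (fun x => - pi^-1 * acos x)).
- exact: measurable_rho.
- by move=> x _; exact: rho_ge0.
- exact: continuous_rho.
- move=> x x1; have d := is_derive1_acos x1.
  by apply: is_derive_eq; rewrite rhoE /GRing.scale /=; ring.
rewrite (_ : (fun n => _) = fun n => 1 - 2 * pi^-1 * h n).
  rewrite -[X in _ --> X](subr0 1) -[X in _ - X](mulr0 (2 * pi^-1)).
  by apply: cvgB; [exact: cvg_cst|apply: cvgMr; exact: h_cvg].
apply/funext => n; rewrite acosN; last first.
  by have := b_gt0 n; have := b_lt1 n => ? ?; apply/andP; split; lra.
by rewrite cosK//; have := gt_eqF (pi_gt0 R); move: (@pi R) => P P0; field; rewrite P0.
Qed.

Lemma itg_rho : itg (@rho R).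
Proof.
apply/integrableP; split; first by apply/measurable_EFinP; exact: measurable_rho.
have -> : (\int[mu]_(x in I) `|(EFin \o @rho R) x| = \int[mu]_(x in I) (rho x)%:E)%E.
  by apply: eq_integral => x _ /=; rewrite ger0_norm// rho_ge0.
by rewrite integral_rho ltry.
Qed.

Lemma int_rho : intI (@rho R) = 1.
Proof. by rewrite /intI /Rintegral integral_rho. Qed.

Lemma int_zcX_rho k : intI (fun x : R => Re (zc x ^+ k.+1) * rho x) = 0.
Proof.
have bC : bmf (fun x : R => Re (zc x ^+ k.+1)) by case: (bmcX k.+1 (@bmc_zc R)).
have iC := itgM bC itg_rho.
have Re1 (x : R) : I x -> `|Re (zc x ^+ k.+1)| <= 1.
  by move=> Ix; apply: normr_Re_le1; rewrite nsqX nsq_zc// expr1n.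
(* Adding [rho], of known integral, makes the integrand nonnegative as [ge0_FTC_I11] requires. *)
suff : intI (fun x : R => (1 + Re (zc x ^+ k.+1)) * rho x) = 1.
  have -> : intI (fun x : R => (1 + Re (zc x ^+ k.+1)) * rho x) = intI (fun x : R => rho x + Re (zc x ^+ k.+1) * rho x).
    by apply: eq_int => x _; rewrite mulrDl mul1r.
  rewrite intD// ?int_rho; [lra|exact: itg_rho].
suff H : (\int[mu]_(x in I) ((1 + Re (zc x ^+ k.+1)) * rho x)%:E = 1%:E)%E.
  by rewrite /intI /Rintegral H.
refine (@ge0_FTC_I11 (fun x => (1 + Re (zc x ^+ k.+1)) * rho x)
  (fun x => - pi^-1 * acos x - pi^-1 * (k.+1%:R)^-1 * Im (zc x ^+ k.+1)) 1 _ _ _ _ _).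
- apply: measurable_funM; last exact: measurable_rho.
  by apply: measurable_funD => //; exact: bmf_meas.
- move=> x /Re1; rewrite ler_norml => /andP[? ?]; apply: mulr_ge0; [lra|exact: rho_ge0].
- move=> x x1; apply: cvgM; last exact: continuous_rho.
  by apply: cvgD; [exact: cvg_cst|exact: ((continuous_zcX R k.+1).1 x)].
- move=> x x1; have d := is_derive1_acos x1; have d2 := (is_derive_zcX k.+1 x1).2.
  apply: is_derive_eq; rewrite rhoE /GRing.scale /=.
  have := gt_eqF (pi_gt0 R); move: (@pi R) => P P0; have y0 := gt_eqF (ysqrt_gt0 x1).
  have : (k.+1%:R : R) != 0 by rewrite pnatr_eq0.
  by move: (k.+1%:R : R) => K K0; field; rewrite P0 y0 K0.
rewrite (_ : (fun n => _) = fun n => (1 - 2 * pi^-1 * h n) - pi^-1 * (k.+1%:R)^-1 * (Im (zc (b n) ^+ k.+1) - Im (zc (- b n) ^+ k.+1))).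
  (* At both endpoints [z] is real, so the sine term of the primitive disappears in the limit. *)
  have Im1 (e : R) : e ^+ 2 = 1 -> Im (zc e ^+ k.+1) = 0.
    move=> e1; rewrite /zc e1 subrr sqrtr0.
    by rewrite -[Complex e 0]/(real_complex R e) -rmorphXn.
  rewrite -[X in _ --> X](subr0 1) -[X in _ - X](mulr0 (pi^-1 * (k.+1%:R)^-1)).
  apply: cvgB.
    rewrite -[X in _ --> X](subr0 1) -[X in _ - X](mulr0 (2 * pi^-1)).
    by apply: cvgB; [exact: cvg_cst|apply: cvgMr; exact: h_cvg].
  apply: cvgMr; rewrite -[X in _ --> X](subr0 0) -[X in X - _](Im1 1) ?expr1n// -[X in _ - X](Im1 (-1)) ?sqrrN ?expr1n//.
  apply: cvgB.
    apply: (@cvg_comp _ _ _ b (fun x => Im (zc x ^+ k.+1)) _ (nbhs (1 : R))); first exact: b_cvg.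
    exact: ((continuous_zcX R k.+1).2 _).
  apply: (@cvg_comp _ _ _ (fun n => - b n) (fun x => Im (zc x ^+ k.+1)) _ (nbhs (-1 : R))).
    by apply: cvgN; exact: b_cvg.
  exact: ((continuous_zcX R k.+1).2 _).
apply/funext => n; rewrite acosN; last first.
  by have := b_gt0 n; have := b_lt1 n => ? ?; apply/andP; split; lra.
rewrite cosK//; have := gt_eqF (pi_gt0 R); move: (@pi R) => P P0.
have : (k.+1%:R : R) != 0 by rewrite pnatr_eq0.
by move: (k.+1%:R : R) => K K0; field; rewrite P0 K0.
Qed.

End arcsine_moments.

(** * Bessel's inequality and the Riemann-Lebesgue lemma *)

Section riemann_lebesgue.
Variable R : realType.
Local Notation I := (@I11 R).
Local Notation C := (R[i]%type).

Lemma itgM_rho (h : R -> R) : bmf h -> itg (fun x => h x * rho x).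
Proof. by move=> bh; apply: itgM bh _; exact: itg_rho. Qed.

(** The system is orthogonal with norms at most 1 but not normalized, so [v n * e n] is not the
    exact projection. Subtracting it still lowers the squared norm of the residual by
    [2 v^2 - v^2 |e|^2 >= v^2]; hence the [v n ^+ 2] are summable and [v n] tends to 0. *)
Lemma bessel_cvg0 (e : nat -> R -> R) (g : R -> R) :
  (forall n, bmf (e n)) -> (forall n x, I x -> `|e n x| <= 1) ->
  (forall i j, (i < j)%N -> intI (fun x => e i x * e j x * rho x) = 0) ->
  bmf g ->
  (fun n => intI (fun x => e n x * g x * rho x)) @ \oo --> (0 : R).
Proof.
move=> be e1 eo bg.
pose v n := intI (fun x => e n x * g x * rho x).
pose r N x := g x - \sum_(i < N) v i * e i x.
have rS N x : r N.+1 x = r N x - v N * e N x.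
  by rewrite /r big_ord_recr /= opprD addrA.
have br N : bmf (r N).
  elim: N => [|N IH].
    by rewrite (_ : r 0%N = g)//; apply/funext => x; rewrite /r big_ord0 subr0.
  rewrite (_ : r N.+1 = fun x => r N x - v N * e N x); last by apply/funext => x; exact: rS.
  by apply: bmfB => //; apply: bmfM => //; exact: bmf_cst.
have er N j : (N <= j)%N -> intI (fun x => e j x * r N x * rho x) = v j.
  elim: N => [|N IH] Nj.
    by apply: eq_int => x _; rewrite /r big_ord0 subr0.
  rewrite -(IH (ltnW Nj)).
  rewrite (@eq_int _ _ (fun x => e j x * r N x * rho x - v N * (e N x * e j x * rho x))); last first.
    by move=> x _; rewrite rS; ring.
  rewrite intB; first by rewrite intZ ?eo ?mulr0 ?subr0//; apply: itgM_rho; exact: bmfM.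
    by apply: itgM_rho; exact: bmfM.
  by apply: itgZ; apply: itgM_rho; exact: bmfM.
have bessel N : \sum_(i < N) v i ^+ 2 <= intI (fun x => g x ^+ 2 * rho x).
  suff : intI (fun x => r N x ^+ 2 * rho x) <= intI (fun x => g x ^+ 2 * rho x) - \sum_(i < N) v i ^+ 2.
    have : 0 <= intI (fun x => r N x ^+ 2 * rho x).
      by apply: int_ge0 => x _; rewrite mulr_ge0 ?sqr_ge0 ?rho_ge0.
    lra.
  elim: N => [|N IH].
    rewrite big_ord0 subr0 le_eqVlt; apply/orP; left; apply/eqP.
    by apply: eq_int => x _; rewrite /r big_ord0 subr0.
  rewrite big_ord_recr /=.
  have i1 : itg (fun x => r N x ^+ 2 * rho x) by apply: itgM_rho; exact: bmfX.
  have i2 : itg (fun x => e N x * r N x * rho x) by apply: itgM_rho; exact: bmfM.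
  have i3 : itg (fun x => e N x ^+ 2 * rho x) by apply: itgM_rho; exact: bmfX.
  have le3 : intI (fun x => e N x ^+ 2 * rho x) <= 1.
    rewrite -(int_rho R); apply: le_int => //; first exact: itg_rho.
    move=> x Ix; rewrite -[leRHS]mul1r ler_wpM2r ?rho_ge0//.
    by rewrite -real_normK ?num_real// expr_le1 ?e1.
  rewrite (@eq_int _ _ (fun x => (r N x ^+ 2 * rho x - (2 * v N) * (e N x * r N x * rho x))
     + v N ^+ 2 * (e N x ^+ 2 * rho x))); last by move=> x _; rewrite rS; ring.
  rewrite intD; [|by apply: itgB => //; exact: itgZ|exact: itgZ].
  rewrite intB//; last exact: itgZ.
  rewrite !intZ// er//.
  have := ler_wpM2l (sqr_ge0 (v N)) le3; rewrite mulr1.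
  by move: IH; rewrite !expr2; lra.
have cv : cvgn (series (fun n => v n ^+ 2)).
  apply: nondecreasing_is_cvgn.
    by apply: nondecreasing_series => n _ _; exact: sqr_ge0.
  exists (intI (fun x => g x ^+ 2 * rho x)) => _ [N _ <-].
  by rewrite /series /= big_mkord.
have v2 := cvg_series_cvg_0 cv.
apply: norm_cvg0.
have -> : (fun n => `|v n|) = (fun n => Num.sqrt (v n ^+ 2)).
  by apply/funext => n; rewrite sqrtr_sqr.
rewrite -[X in _ --> X](@sqrtr0 R).
apply: (cvg_comp _ _ v2); exact: sqrt_continuous.
Qed.

Lemma zcX_ortho (i j : nat) : (i < j)%N ->
  intI (fun x : R => Re (zc x ^+ i) * Re (zc x ^+ j) * rho x) = 0 /\
  intI (fun x : R => Im (zc x ^+ i) * Im (zc x ^+ j) * rho x) = 0.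
Proof.
move=> ij.
have b k : bmf (fun x : R => Re (zc x ^+ k)) by case: (bmcX k (@bmc_zc R)).
have z k : (0 < k)%N -> intI (fun x : R => Re (zc x ^+ k) * rho x) = 0.
  by case: k => // k _; exact: int_zcX_rho.
have ik k : itg (fun x : R => Re (zc x ^+ k) * rho x) by exact: itgM_rho.
have E (x : R) : I x -> Re (zc x ^+ (j - i)) = Re (zc x ^+ i) * Re (zc x ^+ j) + Im (zc x ^+ i) * Im (zc x ^+ j).
  move=> Ix; have -> : zc x ^+ (j - i) = zc x ^+ j * conjc (zc x ^+ i).
    rewrite -{2}(subnK (ltnW ij)) exprD -mulrA mulcJE nsqX nsq_zc// expr1n.
    by rewrite (_ : real_complex R 1 = 1) ?mulr1.
  by rewrite !ReImE; ring.
have E2 (x : R) : Re (zc x ^+ (i + j)) = Re (zc x ^+ i) * Re (zc x ^+ j) - Im (zc x ^+ i) * Im (zc x ^+ j).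
  by rewrite exprD ReM.
have ji0 : (0 < j - i)%N by rewrite subn_gt0.
have ij0 : (0 < i + j)%N by rewrite addn_gt0 (leq_ltn_trans _ ij) ?orbT.
split.
  rewrite (@eq_int _ _ (fun x => 2^-1 * (Re (zc x ^+ (j - i)) * rho x + Re (zc x ^+ (i + j)) * rho x))).
    by rewrite intZ ?intD ?z ?addr0 ?mulr0//; exact: itgD.
  by move=> x Ix; rewrite E// E2; field.
rewrite (@eq_int _ _ (fun x => 2^-1 * (Re (zc x ^+ (j - i)) * rho x - Re (zc x ^+ (i + j)) * rho x))).
  by rewrite intZ ?intB ?z ?subr0 ?mulr0//; exact: itgB.
by move=> x Ix; rewrite E// E2; field.
Qed.

(** Over the half-circle sines are not orthogonal to cosines, so the powers of [z] do not form one
    orthogonal system; cosines and sines are treated as two separate systems. *)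
Lemma riemann_lebesgue (F : R -> C) : bmc F ->
  (fun n => intI (fun x => Re (zc x ^+ n * F x) * rho x)) @ \oo --> (0 : R).
Proof.
move=> [F1 F2].
have b k : bmf (fun x : R => Re (zc x ^+ k)) by case: (bmcX k (@bmc_zc R)).
have b' k : bmf (fun x : R => Im (zc x ^+ k)) by case: (bmcX k (@bmc_zc R)).
have n1 k x : I x -> nsq (zc x ^+ k) <= 1 by move=> Ix; rewrite nsqX nsq_zc// expr1n.
have h1 : (fun n => intI (fun x => Re (zc x ^+ n) * Re (F x) * rho x)) @ \oo --> (0 : R).
  apply: (@bessel_cvg0 (fun n x => Re (zc x ^+ n)) (fun x => Re (F x))) => //.
    by move=> n x Ix; apply: normr_Re_le1; exact: n1.
  by move=> i j /zcX_ortho[].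
have h2 : (fun n => intI (fun x => Im (zc x ^+ n) * Im (F x) * rho x)) @ \oo --> (0 : R).
  apply: (@bessel_cvg0 (fun n x => Im (zc x ^+ n)) (fun x => Im (F x))) => //.
    by move=> n x Ix; apply: normr_Im_le1; exact: n1.
  by move=> i j /zcX_ortho[].
rewrite -(subr0 (0 : R)).
rewrite (_ : (fun n => _) = fun n => intI (fun x => Re (zc x ^+ n) * Re (F x) * rho x) - intI (fun x => Im (zc x ^+ n) * Im (F x) * rho x)).
  exact: cvgB.
apply/funext => n; rewrite -intB; [|by apply: itgM_rho; exact: bmfM..].
by apply: eq_int => x _; rewrite ReM mulrBl.
Qed.

End riemann_lebesgue.

(** * Logarithmic series and Jensen's inequality *)

Section log_series.
Variable R : realType.
Local Notation C := (R[i]%type).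

Lemma nsq_1B (t : R) (u : C) : nsq (1 - real_complex R t * u) = 1 - 2 * t * Re u + t ^+ 2 * nsq u.
Proof. by rewrite /nsq !ReImE /=; ring. Qed.

Lemma nsq_1B_ge (t r : R) (u : C) : nsq u <= r ^+ 2 -> 0 <= r < 1 -> 0 <= t <= 1 ->
  (1 - r) ^+ 2 <= nsq (1 - real_complex R t * u).
Proof.
move=> ur /andP[r0 r1] /andP[t0 t1].
have pr : Re u <= r.
  apply: le_trans (ler_norm _) _; rewrite -(@ler_pXn2r _ 2) ?nnegrE// real_normK ?num_real//.
  exact: le_trans (sqr_Re_le u) ur.
have h : 1 - r <= 1 - t * Re u.
  rewrite lerD2l lerNl opprK; case: (lerP 0 (Re u)) => p0.
    by apply: le_trans pr; rewrite ler_piMl.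
  by apply: le_trans r0; apply: mulr_ge0_le0 => //; exact: ltW.
rewrite nsq_1B /nsq; have h2 : (1 - r) ^+ 2 <= (1 - t * Re u) ^+ 2.
  by rewrite lerXn2r ?nnegrE; lra.
have := sqr_ge0 (t * Im u); nra.
Qed.

(** The real part of the geometric sum [u (1 - (t u)^N) / (1 - t u)], multiplied by
    [|1 - t u|^2]. *)
Lemma log_series_aux (t : R) (u : C) N :
  - Re u + t * nsq u + nsq (1 - real_complex R t * u) * \sum_(k < N) Re (u ^+ k.+1) * t ^+ k =
  - t ^+ N * (Re (u ^+ N.+1) - t * nsq u * Re (u ^+ N)).
Proof.
elim: N => [|N IH].
  by rewrite big_ord0 mulr0 expr0 expr1 expr0 /=; ring.
have -> : \sum_(k < N.+1) Re (u ^+ k.+1) * t ^+ k =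
    \sum_(k < N) Re (u ^+ k.+1) * t ^+ k + Re (u ^+ N.+1) * t ^+ N by rewrite big_ord_recr.
rewrite [X in _ + X = _]mulrDr [LHS]addrA IH nsq_1B.
have -> : Re (u ^+ N.+2) = 2 * Re u * Re (u ^+ N.+1) - nsq u * Re (u ^+ N).
  by rewrite !exprS !ReImE /nsq; ring.
by rewrite !exprS; ring.
Qed.

(** The mean value theorem in [t] along the segment from [0] to [u], which avoids any complex
    logarithm. The case [N = 0] bounds the logarithm itself. *)
Lemma log_series (u : C) (r : R) N : nsq u <= r ^+ 2 -> 0 <= r < 1 ->
  `|ln (nsq (1 - u)) + 2 * \sum_(k < N) Re (u ^+ k.+1) / k.+1%:R| <= 2 * (r ^+ N.+1 / (1 - r)).
Proof.
move=> ur r01; have /andP[r0 r1] := r01.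
pose D t := 1 - 2 * t * Re u + t ^+ 2 * nsq u.
pose S t := \sum_(k < N) Re (u ^+ k.+1) / k.+1%:R * t ^+ k.+1.
pose S' t := \sum_(k < N) Re (u ^+ k.+1) * t ^+ k.
pose h t := ln (D t) + 2 * S t.
pose h' t := (- 2 * Re u + 2 * t * nsq u) / D t + 2 * S' t.
have DE t : D t = nsq (1 - real_complex R t * u) by rewrite nsq_1B.
have D_ge t : 0 <= t <= 1 -> (1 - r) ^+ 2 <= D t by move=> t01; rewrite DE; exact: nsq_1B_ge.
have r2 : 0 < (1 - r) ^+ 2 by rewrite exprn_gt0// subr_gt0.
have D_gt0 t : 0 <= t <= 1 -> 0 < D t by move=> /D_ge; exact: lt_le_trans.
have dS (t : R) : is_derive t (1 : R) S (S' t).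
  rewrite /S /S'; elim: (N) => [|M IH].
    rewrite big_ord0 (_ : (fun _ => _) = fun=> 0); first exact: is_derive_cst.
    by apply/funext => x; exact: big_ord0.
  rewrite big_ord_recr (_ : (fun _ => _) = fun t => \sum_(k < M) Re (u ^+ k.+1) / k.+1%:R * t ^+ k.+1
     + Re (u ^+ M.+1) / M.+1%:R * t ^+ M.+1); last by apply/funext => x; rewrite big_ord_recr.
  have d2 : is_derive t (1 : R) (fun t => Re (u ^+ M.+1) / M.+1%:R * t ^+ M.+1) (Re (u ^+ M.+1) * t ^+ M).
    have dX : is_derive t (1 : R) (fun t => t ^+ M.+1) (M.+1%:R * t ^+ M).
      have := @is_deriveX _ _ id M.+1 t 1 1 (is_derive_id t 1).
      by rewrite /GRing.scale /= mulr1 exprfctE.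
    have := @is_deriveZ _ _ _ _ (Re (u ^+ M.+1) / M.+1%:R) _ _ _ dX.
    by rewrite /GRing.scale /= mulrA mulfVK ?pnatr_eq0.
  exact: is_deriveD.
have dh (t : R) : 0 <= t <= 1 -> is_derive t (1 : R) h (h' t).
  move=> t01; have dD : is_derive t (1 : R) D (- 2 * Re u + 2 * t * nsq u).
    by apply: is_derive_eq; rewrite /GRing.scale /=; ring.
  have dl := is_derive1_ln (D_gt0 t t01).
  have d1 := @is_derive1_comp R (@ln R) D t _ _ dl dD.
  apply: is_derive_eq; rewrite /GRing.scale /= /h'.
  by congr (_ + _); rewrite mulrC.
have h'_le t : 0 <= t <= 1 -> `|h' t| <= 2 * (r ^+ N.+1 / (1 - r)).
  move=> t01; have D0 := D_gt0 t t01; have := log_series_aux t u N; rewrite -DE -/(S' t) => E.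
  have h'E : h' t = - 2 * t ^+ N * (Re (u ^+ N.+1) - t * nsq u * Re (u ^+ N)) / D t.
    rewrite /h'.
    have -> : 2 * S' t = 2 * (D t * S' t) / D t by rewrite (mulrC (D t)) mulrA mulfK ?gt_eqF.
    by rewrite -mulrDl; congr (_ / _); move: E; lra.
  rewrite h'E; have /andP[t0 t1] := t01.
  rewrite -(@ler_pXn2r _ 2) ?nnegrE//; last by rewrite !mulr_ge0 ?exprn_ge0// invr_ge0 subr_ge0 ltW.
  rewrite real_normK ?num_real//.
  (* In this form the numerator is at most [r^(N+1) sqrt (D t)], which cancels one of the two
     factors [sqrt (D t)] of the denominator. Squares are compared to avoid the root. *)
  have -> : Re (u ^+ N.+1) - t * nsq u * Re (u ^+ N) = Re (u ^+ N.+1 * conjc (1 - real_complex R t * u)).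
    by rewrite !exprS !ReImE /nsq /=; ring.
  have le1 : Re (u ^+ N.+1 * conjc (1 - real_complex R t * u)) ^+ 2 <= r ^+ N.+1 ^+ 2 * D t.
    apply: le_trans (sqr_Re_le _) _; rewrite nsqM nsqJ nsqX -DE ler_wpM2r ?(ltW D0)//.
    by rewrite -exprM mulnC exprM lerXn2r ?nnegrE ?nsq_ge0 ?sqr_ge0.
  have tN : (t ^+ N) ^+ 2 <= 1 by rewrite -exprM exprn_ile1.
  set A := Re _ in le1 *.
  have -> : (- 2 * t ^+ N * A / D t) ^+ 2 = 4 * ((t ^+ N) ^+ 2 * (A ^+ 2 / D t) / D t).
    by field; rewrite gt_eqF.
  have -> : (2 * (r ^+ N.+1 / (1 - r))) ^+ 2 = 4 * ((r ^+ N.+1) ^+ 2 / (1 - r) ^+ 2).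
    by field; rewrite gt_eqF// subr_gt0.
  rewrite ler_wpM2l//.
  have AD : A ^+ 2 / D t <= (r ^+ N.+1) ^+ 2 by rewrite ler_pdivrMr.
  apply: ler_pM.
  - by rewrite mulr_ge0 ?sqr_ge0// divr_ge0 ?sqr_ge0 ?ltW.
  - by rewrite invr_ge0 ltW.
  - rewrite -[leRHS]mul1r; apply: ler_pM => //; first exact: sqr_ge0.
    by rewrite divr_ge0 ?sqr_ge0 ?ltW.
  - by rewrite lef_pV2 ?posrE// D_ge.
have ch : {within `[0, 1], continuous h}.
  apply: continuous_in_subspaceT => t; rewrite inE /= in_itv /= => t01.
  apply: differentiable_continuous; apply/derivable1_diffP.
  by have [] := dh t t01.
have [c c01 hc] : exists2 c, c \in `]0, 1[%R & h 1 - h 0 = h' c * (1 - 0).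
  apply: MVT => // t; rewrite in_itv /= => /andP[t0 t1].
  by apply: dh; rewrite !ltW.
have h1 : h 1 = ln (nsq (1 - u)) + 2 * \sum_(k < N) Re (u ^+ k.+1) / k.+1%:R.
  rewrite /h DE mul1r /S; congr (_ + 2 * _).
  by apply: eq_bigr => k _; rewrite expr1n mulr1.
have h0 : h 0 = 0.
  rewrite /h /D /S mulr0 mul0r subr0 expr0n mul0r addr0 ln1 add0r.
  by rewrite big1 ?mulr0// => k _; rewrite expr0n mulr0.
rewrite -h1 -[h 1]subr0 -[X in _ - X]h0 hc subr0 mulr1.
by apply: h'_le; move: c01; rewrite in_itv /= => /andP[? ?]; rewrite !ltW.
Qed.

End log_series.

Section jensen.
Variable R : realType.
Local Notation mu := (@lebesgue_measure R).
Local Notation I := (@I11 R).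
Local Notation C := (R[i]%type).

Definition ev (A : {poly R}) (x : R) : C := (map_poly (real_complex R) A).[zc x].

Lemma real_hornerC (c : R) u : (map_poly (real_complex R) c%:P).[u] = real_complex R c.
Proof. by rewrite map_polyC hornerC. Qed.

Lemma real_hornerMXaddC (A : {poly R}) (c : R) u :
  (map_poly (real_complex R) (A * 'X + c%:P)).[u] =
  (map_poly (real_complex R) A).[u] * u + real_complex R c.
Proof. by rewrite rmorphD rmorphM /= map_polyX map_polyC hornerMXaddC. Qed.

Lemma horner_realJ (A : {poly R}) (u : C) :
  conjc (map_poly (real_complex R) A).[u] = (map_poly (real_complex R) A).[conjc u].
Proof.
elim/poly_ind: A => [|A c IH]; first by rewrite rmorph0 !horner0 conjc0.
by rewrite !real_hornerMXaddC -IH conjcD conjcM conjc_real.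
Qed.

Lemma bmc_ev A : bmc (ev A).
Proof. apply: bmc_horner; exact: bmc_zc. Qed.

Lemma bmf_ln_nsq (F : R -> C) (r : R) : bmc F -> 0 <= r < 1 ->
  (forall x, I x -> nsq (F x) <= r ^+ 2) -> bmf (fun x => ln (nsq (1 - F x))).
Proof.
move=> bF r01 Fr; split.
  apply: measurableT_comp; first exact: measurable_ln.
  apply: bmf_meas; apply: bmf_nsq; apply: bmcD; first exact: bmc_cst.
  by case: bF => F1 F2; split; [under eq_fun do rewrite ReN|under eq_fun do rewrite ImN]; exact: bmfN.
exists (2 * (r ^+ 1 / (1 - r))) => x Ix.
by have := log_series 0 (Fr x Ix) r01; rewrite big_ord0 mulr0 addr0.
Qed.

Lemma Re_powJD (b z : C) k :
  Re ((b * z) ^+ k) + Re ((b * conjc z) ^+ k) = 2 * Re (b ^+ k) * Re (z ^+ k).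
Proof. by rewrite !exprMn -conjcX !ReImE; ring. Qed.

(* Adding the value at [conj z] removes the sine terms of the series, whose integrals
   over the upper half-circle do not vanish. *)
Lemma log_mean (b : C) : nsq b < 1 ->
  itg (fun x => (ln (nsq (1 - b * zc x)) + ln (nsq (1 - b * conjc (zc x)))) * rho x) /\
  intI (fun x => (ln (nsq (1 - b * zc x)) + ln (nsq (1 - b * conjc (zc x)))) * rho x) = 0.
Proof.
move=> b1; pose r := Num.sqrt (nsq b).
have r2 : r ^+ 2 = nsq b by rewrite sqr_sqrtr ?nsq_ge0.
have r01 : 0 <= r < 1.
  rewrite sqrtr_ge0 /= -(@ltr_pXn2r _ 2) ?nnegrE ?sqrtr_ge0//.
  by rewrite r2 expr1n.
have n1 x : I x -> nsq (b * zc x) <= r ^+ 2 by move=> Ix; rewrite nsqM nsq_zc// mulr1 r2.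
have n2 x : I x -> nsq (b * conjc (zc x)) <= r ^+ 2.
  by move=> Ix; rewrite nsqM nsqJ nsq_zc// mulr1 r2.
have bz := @bmc_zc R.
have B : bmf (fun x : R => ln (nsq (1 - b * zc x)) + ln (nsq (1 - b * conjc (zc x)))).
  apply: bmfD; apply: (@bmf_ln_nsq _ r) => //; apply: bmcM (bmc_cst _) _ => //; exact: bmcJ.
have iB := itgM_rho B; split=> //.
set J := intI _.
(* The partial sum of the series integrates to 0 for every [N], so [J] is bounded by the tail
   alone. *)
have key N : `|J| <= 4 * (r ^+ N.+1 / (1 - r)).
  pose T (x : R) := \sum_(k <- iota 0 N) 4 * (Re (b ^+ k.+1) / k.+1%:R) * (Re (zc x ^+ k.+1) * rho x).
  have iz k : itg (fun x : R => Re (zc x ^+ k) * rho x).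
    by apply: itgM_rho; case: (bmcX k bz).
  have iT : itg T by apply: itg_sum => k; exact: itgZ.
  have T0 : intI T = 0.
    rewrite int_sum; last by move=> k; exact: itgZ.
    by rewrite big1// => k _; rewrite intZ// int_zcX_rho mulr0.
  rewrite -[J]addr0 -T0 -intD//.
  apply: le_trans (int_abs _) _; first exact: itgD.
  rewrite -[leRHS]mulr1 -[X in _ <= _ * X](int_rho R) -intZ; last exact: itg_rho.
  apply: le_int; [by apply: itg_abs; exact: itgD|by apply: itgZ; exact: itg_rho|].
  move=> x Ix.
  have -> : T x = 2 * (\sum_(k < N) Re ((b * zc x) ^+ k.+1) / k.+1%:R + \sum_(k < N) Re ((b * conjc (zc x)) ^+ k.+1) / k.+1%:R) * rho x.
    rewrite -big_split mulr_sumr mulr_suml /T -[N in iota _ N]subn0 -/(index_iota 0 N) big_mkord.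
    apply: eq_bigr => k _.
    rewrite [X in _ = 2 * X * _](_ : _ = (Re ((b * zc x) ^+ k.+1) + Re ((b * conjc (zc x)) ^+ k.+1)) / k.+1%:R); last first.
      by rewrite mulrDl.
    rewrite Re_powJD; move: (Re (b ^+ _)) (Re (zc x ^+ _)) => p q.
    have : (k.+1%:R : R) != 0 by rewrite pnatr_eq0.
    by move: (k.+1%:R : R) => K K0; field.
  rewrite -mulrDl normrM (ger0_norm (rho_ge0 x)) ler_wpM2r ?rho_ge0//.
  have := log_series N (n1 x Ix) r01; have := log_series N (n2 x Ix) r01.
  set S1 := \sum_(k < N) _; set S2 := \sum_(k < N) _; set E := _ / _.
  set L1 := ln _; set L2 := ln _; rewrite [2 * (S2 + S1)]mulrDr.
  rewrite !ler_norml => /andP[h1 h2] /andP[h3 h4].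
  by apply/andP; split; lra.
have lim0 : (fun N => 4 / (1 - r) * r ^+ N.+1) @ \oo --> (0 : R).
  rewrite -[X in _ --> X](mulr0 (4 / (1 - r))); apply: cvgMr.
  have := @cvg_expr R r; rewrite ger0_norm; last by case/andP: r01.
  by move=> /(_ (proj2 (andP r01))) rN; rewrite (cvg_shiftS (fun N => r ^+ N)).
apply/eqP; rewrite -normr_le0; apply: (cvgr_to_ge lim0).
by apply: nearW => N; have := key N; rewrite mulrA mulrAC.
Qed.

(** For [t < 1] the zeros of the factors [1 - t b z] are strictly outside the closed disc, even when
    [|b| = 1], and [log_mean] applies to each. *)
Definition logsum (s : seq C) (t : R) (x : R) : R :=
  \sum_(b <- s) (ln (nsq (1 - real_complex R t * b * zc x)) + ln (nsq (1 - real_complex R t * b * conjc (zc x)))).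

Lemma nsq_1B_le (t : R) (u : C) : 0 <= t <= 1 -> nsq u <= 1 ->
  nsq (1 - real_complex R t * u) <= nsq (1 - u) + (1 - t).
Proof.
move=> /andP[t0 t1] u1; rewrite nsq_1B.
have E : nsq (1 - u) = 1 - 2 * Re u + nsq u by rewrite /nsq !ReImE /=; ring.
have t1' : 0 <= 1 - t by rewrite subr_ge0.
have := mulr_ge0 t1' (nsq_ge0 (1 - u)); have := mulr_ge0 (mulr_ge0 t1' t0) (nsq_ge0 u).
by rewrite E; lra.
Qed.

Lemma nsq_1B_le4 (u : C) : nsq u <= 1 -> nsq (1 - u) <= 4.
Proof. by move=> u1; have := nsq_le2 1 (- u); rewrite nsqN nsq1 => ?; lra. Qed.

(** Each factor changes by at most [1 - t] and is at most 4, so the cost of the radius [t] is linear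
    in [1 - t], uniformly on the circle. The bound on the product itself is carried along for the
    induction, which turns [K] into [6 K + 6]. *)
Lemma prod_nsq_bound (s : seq C) : {in s, forall b, nsq b <= 1} ->
  exists K : R, 0 <= K /\ forall (t : R) (u : C), 0 <= t <= 1 -> nsq u = 1 ->
  \prod_(b <- s) nsq (1 - real_complex R t * b * u) <=
    \prod_(b <- s) nsq (1 - b * u) + (1 - t) * K /\ \prod_(b <- s) nsq (1 - b * u) <= K + 1.
Proof.
elim: s => [_|a s IH sb].
  by exists 0; split => // t u _ _; rewrite !big_nil mulr0 addr0 add0r.
have [K [K0 HK]] := IH (fun b bs => sb b (@mem_behead _ (a :: s) b bs)).
exists (K * 6 + 6); split => [|t u t01 u1]; first lra.
have [h1 h2] := HK t u t01 u1; rewrite !big_cons.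
have au : nsq (a * u) <= 1 by rewrite nsqM u1 mulr1 sb// mem_head.
have h3 := nsq_1B_le t01 au; have h4 := nsq_1B_le4 au; rewrite mulrA in h3.
have p1 : 0 <= \prod_(b <- s) nsq (1 - b * u) by apply: prodr_ge0 => b _; exact: nsq_ge0.
have p2 : 0 <= \prod_(b <- s) nsq (1 - real_complex R t * b * u) by apply: prodr_ge0 => b _; exact: nsq_ge0.
have n1 := nsq_ge0 (1 - a * u); have n2 := nsq_ge0 (1 - real_complex R t * a * u).
move: h1 h2 h3 h4 p1 p2 n1 n2; case/andP: t01.
set P := \prod_(b <- s) nsq (1 - b * u); set Q := \prod_(b <- s) _.
set n := nsq (1 - a * u); set m := nsq _ => t0 t1 h1 h2 h3 h4 p1 p2 n1 n2.
split.
  apply: le_trans (_ : (n + (1 - t)) * (P + (1 - t) * K) <= _); first exact: ler_pM.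
  have : (1 - t) * P <= (1 - t) * (K + 1) by rewrite ler_wpM2l; lra.
  have : (1 - t) * K * n <= (1 - t) * K * 4 by rewrite ler_wpM2l// mulr_ge0; lra.
  have : (1 - t) * (1 - t) * K <= (1 - t) * 1 * K by rewrite ler_wpM2r// ler_wpM2l; lra.
  lra.
have : n * P <= 4 * (K + 1) by exact: ler_pM.
lra.
Qed.

(* A root [r] inside the disc is reflected to [1 / conj r], which decreases the modulus
   on the circle by the factor [|r|]. *)
Lemma root_flip (r : C) : r != 0 -> exists b : C, nsq b <= 1 /\
  forall u, nsq u = 1 -> nsq (1 - b * u) <= nsq (1 - r^-1 * u).
Proof.
move=> r0; have nr0 : 0 < nsq r by rewrite lt_neqAle nsq_ge0 eq_sym nsq_eq0 r0.
have [r1|r1] := lerP (nsq r) 1.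
  exists (conjc r); split; first by rewrite nsqJ.
  move=> u u1.
  have -> : nsq (1 - conjc r * u) = nsq r * nsq (1 - r^-1 * u).
    rewrite -nsqM mulrBr mulr1 mulrA mulfV// mul1r.
    rewrite -[RHS]nsqJ -[RHS]mul1r -u1 -nsqM conjcB mulrBr mulcJE u1.
    by rewrite (_ : real_complex R 1 = 1)// -nsqN opprB mulrC.
  by rewrite ler_piMl ?nsq_ge0.
exists r^-1; split => //.
have : nsq r * nsq r^-1 = 1 by rewrite -nsqM mulfV// /nsq /= expr1n expr0n addr0.
by have := nsq_ge0 r^-1; nra.
Qed.

(** The normalization makes [A] the product of [1 - u / r] over its roots [r], and [root_flip]
    minorizes each factor. As [A] is real, [|A|] agrees at [z] and [conj z], so one list [s] serves
    both points, as [log_mean] demands. *)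
Lemma ev_prod_lower (A : {poly R}) : A.[0] = 1 ->
  exists s : seq C, {in s, forall b, nsq b <= 1} /\
  forall x, I x -> \prod_(b <- s) nsq (1 - b * zc x) <= nsq (ev A x) /\
    \prod_(b <- s) nsq (1 - b * conjc (zc x)) <= nsq (ev A x).
Proof.
move=> A1.
have [rs Ars] := closed_field_poly_normal (map_poly (real_complex R) A).
set l := lead_coef _ in Ars.
have hor u : (map_poly (real_complex R) A).[u] = l * \prod_(r <- rs) (u - r).
  by rewrite Ars hornerZ horner_prod; congr (_ * _); apply: eq_bigr => r _; rewrite hornerXsubC.
have A0 : l * \prod_(r <- rs) (0 - r) = 1.
  by rewrite -hor -[X in _.[X]](rmorph0 (real_complex R)) horner_map A1 rmorph1.
have rn0 r : r \in rs -> r != 0.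
  apply: contraTneq => -> ; apply/negP => rs0.
  move: A0; rewrite (big_rem _ rs0) /= subr0 mul0r mulr0 => /eqP.
  by rewrite eq_sym oner_eq0.
have main u : (map_poly (real_complex R) A).[u] = \prod_(r <- rs) (1 - r^-1 * u).
  rewrite hor; have -> : \prod_(r <- rs) (u - r) = \prod_(r <- rs) (0 - r) * \prod_(r <- rs) (1 - r^-1 * u).
    rewrite -big_split /= !big_seq; apply: eq_bigr => r /rn0 r0.
    by rewrite sub0r mulrBr mulr1 mulrA mulNr mulfV// mulN1r opprK addrC.
  by rewrite mulrA A0 mul1r.
have [s [s1 s2]] : exists s : seq C, {in s, forall b, nsq b <= 1} /\ forall u, nsq u = 1 ->
   \prod_(b <- s) nsq (1 - b * u) <= \prod_(r <- rs) nsq (1 - r^-1 * u).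
  elim: (rs) rn0 => [_|r q IH qn0]; first by exists [::]; split => // u _; rewrite !big_nil.
  have [s [s1 s2]] := IH (fun b bs => qn0 b (@mem_behead _ (r :: q) b bs)).
  have [b [b1 b2]] := root_flip (qn0 r (mem_head _ _)).
  exists (b :: s); split => [c|u u1].
    by rewrite inE => /predU1P[->//|]; exact: s1.
  rewrite !big_cons; apply: ler_pM; rewrite ?nsq_ge0 ?b2 ?s2//.
  by apply: prodr_ge0 => c _; exact: nsq_ge0.
have nprod u : nsq (\prod_(r <- rs) (1 - r^-1 * u)) = \prod_(r <- rs) nsq (1 - r^-1 * u).
  exact: (big_morph _ (@nsqM R) (@nsq1 R)).
exists s; split => // x Ix; split.
  by rewrite /ev main nprod s2// nsq_zc.
have -> : nsq (ev A x) = nsq (map_poly (real_complex R) A).[conjc (zc x)].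
  by rewrite -horner_realJ nsqJ.
by rewrite main nprod s2// nsqJ nsq_zc.
Qed.

End jensen.

(** * A positive lower bound for the Szego extremal problem *)

Section szego_class.
Variable R : realType.
Local Notation mu := (@lebesgue_measure R).
Local Notation I := (@I11 R).
Local Notation C := (R[i]%type).
Variable w : R -> R.
Hypothesis w_ge0 : forall x, I x -> 0 <= w x.
Hypothesis w_itg : itg w.

Definition ip (A B : {poly R}) : R := intI (fun x => Re (ev A x * conjc (ev B x)) * w x).
Definition nrm (A : {poly R}) : R := intI (fun x => nsq (ev A x) * w x).

Lemma itgM_w h : bmf h -> itg (fun x => h x * w x).
Proof. by move=> bh; exact: itgM. Qed.

Lemma w0_rho (x : R) : -1 < x < 1 -> w0 w x * rho x = w x.
Proof.
move=> x1; have y0 := ysqrt_gt0 x1; rewrite /w0 /rho mulrAC mulfV ?mul1r//.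
by rewrite gt_eqF// mulr_gt0 ?pi_gt0.
Qed.

(** The inverse of 0 is 0. This settles pointwise the two endpoints, the only places where [w0_rho]
    does not apply. *)
Lemma rho_endpoint (x : R) : I x -> ~ (-1 < x < 1) -> rho x = 0.
Proof.
move=> /I11E /andP[x1 x2] /negP; rewrite negb_and -!leNgt => h.
have x2E : x ^+ 2 = 1.
  case/orP: h => h; first by rewrite (_ : x = -1) ?sqrrN ?expr1n//; apply/eqP; rewrite eq_le h.
  by rewrite (_ : x = 1) ?expr1n//; apply/eqP; rewrite eq_le x2.
by rewrite /rho x2E subrr sqrtr0 mulr0 invr0.
Qed.

Lemma logsum_mean (s : seq C) (t : R) : {in s, forall b, nsq b <= 1} -> 0 <= t < 1 ->
  itg (fun x => logsum s t x * rho x) /\ intI (fun x => logsum s t x * rho x) = 0.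
Proof.
move=> + t01; have /andP[t0 t1] := t01; elim: s => [_|b s IH sb].
  have E (x : R) : I x -> (fun=> 0 : R) x = logsum [::] t x * rho x by rewrite /logsum big_nil mul0r.
  by split; [exact: (eq_itg E (@itg0 R))|rewrite -(eq_int E) int0].
have [i1 e1] := IH (fun a as_ => sb a (@mem_behead _ (b :: s) a as_)).
have tb : nsq (real_complex R t * b) < 1.
  rewrite nsqM {1}/nsq /= expr0n addr0.
  have b1 := sb b (mem_head _ _); have b0 := nsq_ge0 b.
  have t2 : t ^+ 2 < 1 by rewrite expr_lt1.
  have : t ^+ 2 * nsq b <= t ^+ 2 * 1 by rewrite ler_wpM2l// sqr_ge0.
  lra.
have [i2 e2] := log_mean tb.
have E (x : R) : I x -> (ln (nsq (1 - real_complex R t * b * zc x)) + ln (nsq (1 - real_complex R t * b * conjc (zc x)))) * rho x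
   + logsum s t x * rho x = logsum (b :: s) t x * rho x.
  by move=> _; rewrite /logsum big_cons -mulrDl.
split; first by apply: (eq_itg E); exact: itgD.
by rewrite -(eq_int E) intD// e1 e2 addr0.
Qed.

Lemma ln_prod_nsq (s : seq C) (t : R) (u : C) : {in s, forall b, nsq b <= 1} -> 0 <= t < 1 ->
  nsq u = 1 -> 0 < \prod_(b <- s) nsq (1 - real_complex R t * b * u) /\
  ln (\prod_(b <- s) nsq (1 - real_complex R t * b * u)) = \sum_(b <- s) ln (nsq (1 - real_complex R t * b * u)).
Proof.
move=> + t01 u1; have /andP[t0 t1] := t01; elim: s => [_|b s IH sb].
  by rewrite !big_nil ln1.
have [p0 pE] := IH (fun a as_ => sb a (@mem_behead _ (b :: s) a as_)).
have n0 : 0 < nsq (1 - real_complex R t * b * u).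
  have h : nsq (real_complex R t * b * u) <= t ^+ 2.
    rewrite !nsqM u1 mulr1 {1}/nsq /= expr0n addr0.
    by rewrite ler_piMr ?sqr_ge0// sb// mem_head.
  have := @nsq_1B_ge R 1 t _ h t01; rewrite real_complex1 mul1r ler01 lexx => /(_ isT).
  by apply: lt_le_trans; rewrite exprn_gt0// subr_gt0.
rewrite !big_cons -pE; split; first exact: mulr_gt0.
by rewrite lnM ?posrE.
Qed.

Lemma bmf_prod_nsq (s : seq C) (t : R) (F : R -> C) : bmc F ->
  bmf (fun x => \prod_(b <- s) nsq (1 - real_complex R t * b * F x)).
Proof.
move=> bF; elim: (s) => [|b q IH].
  by under eq_fun do rewrite big_nil; exact: bmf_cst.
under eq_fun do rewrite big_cons; apply: bmfM => //; apply: bmf_nsq.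
under eq_fun do rewrite -mulNr; apply: bmcD (bmc_cst _) _; exact: bmcM (bmc_cst _) bF.
Qed.

(** The exponential lies above its tangent at [ln l]. Besides Jensen's inequality, this yields the
    elementary bounds on [a * ln a] used for the entropy. *)
Lemma exp_tangent (l u : R) : 0 < l -> 0 < u -> l * (1 + ln u - ln l) <= u.
Proof.
move=> l0 u0; have ul : 0 < u / l by rewrite divr_gt0.
have : ln (1 + (u / l - 1)) <= u / l - 1 by apply: le_ln1Dx; lra.
rewrite subrKC lnM ?posrE ?invr_gt0// lnV ?posrE// => h.
have E : l * (u / l - 1) = u - l by field; rewrite gt_eqF.
by have := ler_wpM2l (ltW l0) h; rewrite E; lra.
Qed.

Hypothesis w0_pos : {ae mu, forall x, I x -> 0 < w0 w x}.
Hypothesis logw0 : itg (fun x => ln (w0 w x) * rho x).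

Definition geom_mean : R := expR (intI (fun x => ln (w0 w x) * rho x)).

(* Jensen's inequality for [ln], in the form of the tangent inequality at [geom_mean]. *)
Lemma geom_mean_le (s : seq C) (t : R) : {in s, forall b, nsq b <= 1} -> 0 <= t < 1 ->
  geom_mean <= intI (fun x => 2^-1 * (\prod_(b <- s) nsq (1 - real_complex R t * b * zc x)
     + \prod_(b <- s) nsq (1 - real_complex R t * b * conjc (zc x))) * w x).
Proof.
move=> s1 t01; set G := geom_mean.
have G0 : 0 < G by exact: expR_gt0.
have lnG : ln G = intI (fun x => ln (w0 w x) * rho x) by rewrite expRK.
have [iL eL] := logsum_mean s1 t01.
have bz := @bmc_zc R; have bzJ := bmcJ bz.
have bprod := fun F bF => @bmf_prod_nsq s t F bF.
set V := fun x : R => 2^-1 * (_ + _) * w x.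
have iV : itg V.
  by apply: itgM_w; apply: bmfM (bmf_cst _) _; apply: bmfD; exact: bprod.
(* The average of the tangent minorants at [z] and [conj z]. The logarithmic sums integrate to 0, so
   the integral of [H] is [G (1 - ln G) + G ln G = G]. *)
pose H x := G * (1 - ln G) * rho x + G * (2^-1 * (logsum s t x * rho x) + ln (w0 w x) * rho x).
have iH1 : itg (fun x => 2^-1 * (logsum s t x * rho x) + ln (w0 w x) * rho x) by apply: itgD => //; exact: itgZ.
have iH : itg H by apply: itgD; apply: itgZ => //; exact: itg_rho.
have EH : intI H = G.
  rewrite intD; [|by apply: itgZ; exact: itg_rho|exact: itgZ].
  rewrite !intZ//; last exact: itg_rho.
  rewrite intD//; last exact: itgZ.
  by rewrite intZ// eL int_rho -lnG; ring.
rewrite -[leLHS]EH -subr_ge0 -intB//; apply: ae_ge0_int; first exact: itgB.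
(* As [ln] is 0 on nonpositive numbers, integrability of [ln (w0 w x)] does not exclude zeros of
   [w0]; the tangent inequality needs positivity almost everywhere. *)
move: w0_pos; apply: (@filterS _ _ (ae_filter_ringOfSetsType mu)) => x w0x Ix.
have [x1|x1] := pselect (-1 < x < 1); last first.
  have r0 := rho_endpoint Ix x1.
  rewrite /H r0 !mulr0 addr0 mulr0 addr0 subr0 /V mulr_ge0 ?w_ge0// mulr_ge0 ?invr_ge0//.
  by rewrite addr_ge0// prodr_ge0// => b _; exact: nsq_ge0.
have {}w0x := w0x Ix.
have [p1 q1] := ln_prod_nsq s1 t01 (nsq_zc Ix).
have [p2 q2] : _ /\ _ := ln_prod_nsq s1 t01 (etrans (nsqJ (zc x)) (nsq_zc Ix)).
rewrite subr_ge0 /V -(w0_rho x1) /H /logsum big_split /= -q1 -q2.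
set v1 := \prod_(b <- s) _ in p1 q1 *; set v2 := \prod_(b <- s) _ in p2 q2 *.
have h1 := exp_tangent G0 (mulr_gt0 p1 w0x); have h2 := exp_tangent G0 (mulr_gt0 p2 w0x).
rewrite lnM ?posrE// in h1; rewrite lnM ?posrE// in h2.
have := ler_wpM2r (rho_ge0 x) h1; have := ler_wpM2r (rho_ge0 x) h2.
lra.
Qed.

(** Let [t] tend to 1 in [geom_mean_le]: by [prod_nsq_bound] the error is at most [(1 - t) K int w],
    even if [A] has zeros on the circle. *)
Lemma jensen_lower (A : {poly R}) : A.[0] = 1 -> geom_mean <= nrm A.
Proof.
move=> A1; have [s [s1 s2]] := ev_prod_lower A1.
have [K [K0 HK]] := prod_nsq_bound s1.
have iN : itg (fun x => nsq (ev A x) * w x) by apply: itgM_w; apply: bmf_nsq; exact: bmc_ev.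
have key (t : R) : 0 <= t < 1 -> geom_mean <= nrm A + (1 - t) * (K * intI w).
  move=> t01; have /andP[t0 t1] := t01.
  have t01' : 0 <= t <= 1 by rewrite t0 ltW.
  apply: le_trans (geom_mean_le s1 t01) _.
  rewrite mulrA -intZ// -intD//; last exact: itgZ.
  have bz := @bmc_zc R; have bzJ := bmcJ bz.
  apply: le_int.
  - by apply: itgM_w; apply: bmfM (bmf_cst _) _; apply: bmfD; exact: bmf_prod_nsq.
  - by apply: itgD => //; exact: itgZ.
  - move=> x Ix; rewrite -mulrDl; apply: ler_wpM2r; first exact: w_ge0.
    have [a1 _] := HK t _ t01' (nsq_zc Ix).
    have [a2 _] := HK t _ t01' (etrans (nsqJ (zc x)) (nsq_zc Ix)).
    have [a3 a4] := s2 x Ix.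
    by move: a1 a2 a3 a4; lra.
set c := K * intI w in key.
have c0 : 0 <= c by rewrite mulr_ge0// int_ge0.
apply/ler_addgt0Pr => e e0.
have d0 : 0 < Order.min 1 (e / (c + 1)) by rewrite lt_min ltr01 divr_gt0// ltr_wpDl.
have d1 : Order.min 1 (e / (c + 1)) <= 1 by rewrite ge_min lexx.
have d2 : Order.min 1 (e / (c + 1)) * (c + 1) <= e.
  by rewrite -ler_pdivlMr ?ltr_wpDl// ge_min lexx orbT.
move: d0 d1 d2; set d := Order.min _ _ => d0 d1 d2.
have := key (1 - d); rewrite opprB subrKC => /(_ _).
have -> : 0 <= 1 - d < 1 by apply/andP; split; lra.
move=> /(_ isT) h; nra.
Qed.

End szego_class.

(** * Polynomial test functions *)

Section weierstrass.
Variable R : realType.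
Local Notation I := (@I11 R).
Implicit Types f c : R -> R.

(* Bernstein's polynomials in the variable [(1 + X) / 2], built by Pascal's recurrence. *)
Fixpoint bernstein (n : nat) (f : nat -> R) : {poly R} :=
  if n is m.+1 then (1 - 2^-1 *: (1 + 'X)) * bernstein m f
                    + 2^-1 *: (1 + 'X) * bernstein m (fun k => f k.+1)
  else (f 0%N)%:P.

(** With [y = (1 + x) / 2], the last factor is the binomial mean of [(k - a)^2], that is squared
    bias plus variance. The induction conditions on one trial, whose success replaces [a] by
    [a - 1]. *)
Lemma bernstein_bound n (f : nat -> R) (x v al be a : R) : I x ->
  (forall k, (k <= n)%N -> `|f k - v| <= al + be * (k%:R - a) ^+ 2) ->
  `|(bernstein n f).[x] - v| <=
    al + be * ((n%:R * (2^-1 * (1 + x)) - a) ^+ 2 + n%:R * ((2^-1 * (1 + x)) * (1 - 2^-1 * (1 + x)))).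
Proof.
move=> /I11E /andP[x1 x2]; elim: n f a => [|n IH] f a Hf /=.
  by rewrite hornerC; have := Hf 0%N (leqnn _); rewrite !mul0r addr0.
set b1 := bernstein n f; set b2 := bernstein n _.
have -> : ((1 - 2^-1 *: (1 + 'X)) * b1 + 2^-1 *: (1 + 'X) * b2).[x] =
    (1 - 2^-1 * (1 + x)) * b1.[x] + 2^-1 * (1 + x) * b2.[x] by rewrite !hornerE.
set y := 2^-1 * (1 + x).
have y0 : 0 <= y by rewrite /y; lra.
have y1 : 0 <= 1 - y by rewrite /y; lra.
have h1 := IH f a (fun k kn => Hf k (leqW kn)).
have h2 := IH (fun k => f k.+1) (a - 1).
have {}h2 : `|(bernstein n (fun k : nat => f k.+1)).[x] - v| <=
       al + be * ((n%:R * y - (a - 1)) ^+ 2 + n%:R * (y * (1 - y))).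
  apply: h2 => k kn; apply: le_trans (Hf k.+1 kn) _.
  by rewrite -natr1 (_ : k%:R + 1 - a = k%:R - (a - 1))//; ring.
move: h1 h2; rewrite -/y -/b1 -/b2 => h1 h2; clearbody y.
have -> : (1 - y) * b1.[x] + y * b2.[x] - v = (1 - y) * (b1.[x] - v) + y * (b2.[x] - v) by ring.
apply: le_trans (ler_normD _ _) _; rewrite !normrM (ger0_norm y0) (ger0_norm y1).
apply: le_trans (lerD (ler_wpM2l y1 h1) (ler_wpM2l y0 h2)) _.
by rewrite -natr1 le_eqVlt; apply/orP; left; apply/eqP; ring.
Qed.

(** Uniform continuity gives a [d] for close points; for the others [2 <= 2 (u - v)^2 / d^2]. The
    quadratic shape is the one that [bernstein_bound] averages. *)
Lemma modulus_sqr c (e : R) : continuous c -> (forall x, I x -> `|c x| <= 1) -> 0 < e ->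
  exists K : R, 0 <= K /\ forall u v, I u -> I v -> `|c u - c v| <= e + K * (u - v) ^+ 2.
Proof.
move=> cc c1 e0.
pose P (d u : R) := forall v, `|u - v| < d -> `|c u - c v| <= e.
have : \forall d \near (0 : R)^'+, I `<=` P d.
  have cI : compact I by exact: segment_compact.
  apply: (proj1 (compact_near_coveringP I) cI R (0 : R)^'+ P _) => u0 _.
  have e2 : 0 < e / 2 by rewrite divr_gt0.
  have /cvgrPdist_lt/(_ _ e2) := cc u0.
  move=> /nbhs_ballP[r /= r0 Hr].
  have r2 : 0 < r / 2 by rewrite divr_gt0.
  exists (ball u0 (r / 2), [set d | 0 < d < r / 2]) => /=.
    split; first exact: nbhsx_ballx.
    near=> d; apply/andP; split; near: d; [exact: nbhs_right_gt|exact: nbhs_right_lt].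
  move=> [u d] /= [u1 /andP[d0 d1]] v uv.
  rewrite /ball /= in u1.
  have h1 : `|c u0 - c u| < e / 2 by apply: Hr; rewrite /ball /=; lra.
  have h2 : `|c u0 - c v| < e / 2.
    apply: Hr; rewrite /ball /=; apply: le_lt_trans (ler_distD u _ _) _; lra.
  apply: le_trans (ler_distD (c u0) _ _) _; rewrite distrC; lra.
move=> H.
have [d [d0 Hd]] : exists d, 0 < d /\ I `<=` P d.
  have FF := at_right_proper_filter (0 : R).
  have [d [d1 d2]] := @filter_ex _ _ FF _ (@filterI _ _ FF _ _ H (nbhs_right_gt (0 : R))).
  by exists d.
exists (2 / d ^+ 2); split; first by rewrite divr_ge0 ?sqr_ge0.
move=> u v Iu Iv; have [uv|uv] := ltP `|u - v| d.
  by apply: le_trans (Hd u Iu v uv) _; rewrite lerDl mulr_ge0 ?sqr_ge0 ?divr_ge0 ?sqr_ge0.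
apply: le_trans (ler_normB _ _) _.
apply: le_trans (_ : 2 <= _); first by have := c1 u Iu; have := c1 v Iv; lra.
have : 2 <= 2 / d ^+ 2 * (u - v) ^+ 2.
  rewrite mulrAC ler_pdivlMr ?exprn_gt0// ler_wpM2l// -[leRHS]real_normK ?num_real//.
  by rewrite lerXn2r ?nnegrE ?(ltW d0).
lra.
Unshelve. all: by end_near. Qed.

(** Bernstein's approximants also preserve the bound 1, which test polynomials must satisfy: this is
    [bernstein_bound] with [al = 1] and [be = 0]. *)
Lemma weierstrass c (e : R) : continuous c -> (forall x, I x -> `|c x| <= 1) -> 0 < e ->
  exists T : {poly R}, forall x, I x -> `|T.[x]| <= 1 /\ `|T.[x] - c x| <= e.
Proof.
move=> cc c1 e0; have e2 : 0 < e / 2 by rewrite divr_gt0.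
have [K [K0 HK]] := modulus_sqr cc c1 e2.
pose n := (Num.bound (2 * K / e)).+1.
have n0 : (0 : R) < n%:R by rewrite ltr0n.
have Kn : K / n%:R <= e / 2.
  rewrite ler_pdivrMr// mulrC -ler_pdivrMr// invf_div mulrA (mulrC _ 2).
  apply: le_trans (ltW (archi_boundP _)) _.
    by rewrite divr_ge0 ?mulr_ge0// ltW.
  by rewrite ler_nat leqnSn.
have node k : (k <= n)%N -> I (2 * (k%:R / n%:R) - 1).
  move=> kn; apply/I11E.
  have h0 : 0 <= (k%:R / n%:R : R) by rewrite divr_ge0.
  have h1 : (k%:R / n%:R : R) <= 1 by rewrite ler_pdivrMr// mul1r ler_nat.
  by apply/andP; split; lra.
exists (bernstein n (fun k => c (2 * (k%:R / n%:R) - 1))) => x Ix.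
split.
  have := @bernstein_bound n (fun k => c (2 * (k%:R / n%:R) - 1)) x 0 1 0 0 Ix.
  rewrite subr0 mul0r addr0; apply => k kn.
  by rewrite subr0 mul0r addr0 c1//; exact: node.
(* Centring at the binomial mean [n y] kills the bias; the nodes have spacing [2 / n], so the
   variance term is [(K / n) (1 - x^2)]. *)
have := @bernstein_bound n (fun k => c (2 * (k%:R / n%:R) - 1)) x (c x) (e / 2)
  (K * (2 / n%:R) ^+ 2) (n%:R * (2^-1 * (1 + x))) Ix.
have hk k : (k <= n)%N -> `|c (2 * (k%:R / n%:R) - 1) - c x| <=
    e / 2 + K * (2 / n%:R) ^+ 2 * (k%:R - n%:R * (2^-1 * (1 + x))) ^+ 2.
  move=> kn; apply: le_trans (HK _ _ (node k kn) Ix) _.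
  rewrite le_eqVlt; apply/orP; left; apply/eqP; field.
  by rewrite gt_eqF.
move=> /(_ hk) /le_trans; apply.
rewrite subrr expr0n add0r.
have -> : K * (2 / n%:R) ^+ 2 * (n%:R * (2^-1 * (1 + x) * (1 - 2^-1 * (1 + x)))) = K / n%:R * (1 - x ^+ 2).
  by field; rewrite gt_eqF.
have : K / n%:R * (1 - x ^+ 2) <= K / n%:R * 1.
  by rewrite ler_wpM2l ?divr_ge0 ?(ltW n0)// lerBlDr lerDl sqr_ge0.
lra.
Qed.

Lemma bmf_continuous c : continuous c -> (forall x, I x -> `|c x| <= 1) -> bmf c.
Proof.
move=> cc c1; apply: bmf_le1 => //; apply: measurable_funTS.
exact: continuous_measurable_fun.
Qed.

Lemma L1_norm_le_continuous_test (g : R -> R) (k : R) : itg g ->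
  (forall T : {poly R}, (forall x, I x -> `|T.[x]| <= 1) -> intI (fun x => T.[x] * g x) <= k) ->
  forall c, continuous c -> (forall x, I x -> `|c x| <= 1) -> intI (fun x => c x * g x) <= k.
Proof.
move=> ig Hk c cc c1; have iag := itg_abs ig.
have G0 : 0 <= intI (fun x => `|g x|) by exact: int_ge0.
apply/ler_addgt0Pr => e e0.
have e1 : 0 < e / (intI (fun x => `|g x|) + 1) by rewrite divr_gt0// ltr_wpDl.
have [T HT] := weierstrass cc c1 e1.
have bT : bmf (fun x => T.[x]) by apply: bmf_horner; exact: bmf_id.
have bc := bmf_continuous cc c1.
have h : intI (fun x => c x * g x) <= intI (fun x => T.[x] * g x + e / (intI (fun x => `|g x|) + 1) * `|g x|).
  apply: le_int; [exact: itgM|by apply: itgD; [exact: itgM|exact: itgZ]|move=> x Ix].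
  have [_ h] := HT x Ix; rewrite -lerBlDl -mulrBl.
  apply: le_trans (ler_norm _) _; rewrite normrM ler_wpM2r//.
  by rewrite distrC.
apply: le_trans h _; rewrite intD; [|exact: itgM|exact: itgZ].
rewrite intZ//; apply: lerD; first by apply: Hk => x /HT[].
rewrite mulrAC ler_pdivrMr ?ltr_wpDl// ler_wpM2l ?(ltW e0)//.
by rewrite lerDl.
Qed.

(** Duality between [L^1] and bounded tests. The sign of [g] is replaced by [c / (|c| + h)], for a
    continuous [c] close to [g] in [L^1]. *)
Lemma L1_norm_le_poly_test (g : R -> R) (k : R) : itg g ->
  (forall T : {poly R}, (forall x, I x -> `|T.[x]| <= 1) -> intI (fun x => T.[x] * g x) <= k) ->
  intI (fun x => `|g x|) <= k.
Proof.
move=> ig Hk; have Hc := L1_norm_le_continuous_test ig Hk.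
apply/ler_addgt0Pr => e e0; have e4 : 0 < e / 4 by rewrite divr_gt0.
have [c [cc [ic dc]]] : exists c, continuous c /\ itg c /\ intI (fun x => `|g x - c x|) < e / 4.
  have [c_ [cc ic lim]] := @approximation_continuous_integrable R I g (@mIL R) (mu_I_fin R) ig.
  have /fine_cvgP[_ /cvgrPdist_lt/(_ _ e4)[N _ HN]] := lim.
  exists (c_ N); split; first exact: cc.
  split; first exact: ic.
  have := HN N (leqnn _); rewrite sub0r normrN /=; apply: le_lt_trans.
  apply: le_trans (ler_norm _); rewrite /intI /Rintegral.
  by rewrite (_ : (fun z => (`|g z - c_ N z|)%:E) = (fun z => `|(g z - c_ N z)%:E|%E)).
(* The total error is [2 (e / 4)] from replacing [g] by [c], plus [2 h = e / 4] because the interval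
   has length 2. *)
pose h := e / 8.
have h0 : 0 < h by rewrite divr_gt0.
pose T x := c x / (`|c x| + h).
have den x : 0 < `|c x| + h by rewrite ltr_wpDl.
have cT : continuous T.
  move=> x; apply: cvgM; first exact: cc.
  apply: cvgV; first by rewrite gt_eqF.
  by apply: cvgD; [apply: cvg_norm; exact: cc|exact: cvg_cst].
have T1 x : I x -> `|T x| <= 1.
  move=> _; rewrite normrM normfV (gtr0_norm (den x)) ler_pdivrMr// mul1r.
  by rewrite lerDl ltW.
have cTle x : `|c x| <= c x * T x + h.
  rewrite /T mulrA -expr2 -real_normK ?num_real//; have := den x; set a := `|c x| => a0.
  rewrite -lerBlDr ler_pdivlMr// expr2; have := sqr_ge0 h; rewrite expr2; nra.
have bT := bmf_continuous cT T1.
have idc : itg (fun x => `|g x - c x|) by apply: itg_abs; exact: itgB.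
have i1 : itg (fun x => T x * g x) by exact: itgM.
have step : intI (fun x => `|g x|) <= intI (fun x => T x * g x + (2 * `|g x - c x| + h)).
  apply: le_int; first exact: itg_abs.
    by apply: itgD => //; apply: itgD; [exact: itgZ|exact: itg_bmf (bmf_cst _)].
  move=> x Ix; have a1 : `|g x| <= `|g x - c x| + `|c x| by rewrite -{1}(subrK (c x) (g x)) ler_normD.
  have a2 : c x * T x - T x * g x <= `|g x - c x|.
    rewrite mulrC -mulrBr; apply: le_trans (ler_norm _) _; rewrite normrM distrC.
    by rewrite ler_piMl// T1.
  have := cTle x; lra.
apply: le_trans step _; rewrite intD//; last first.
  by apply: itgD; [exact: itgZ|exact: itg_bmf (bmf_cst _)].
rewrite intD; [|exact: itgZ|exact: itg_bmf (bmf_cst _)].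
rewrite intZ//; have a1 := Hc T cT T1.
have -> : intI (fun=> h) = h * 2.
  by rewrite /intI Rintegral_cst//; congr (_ * _); exact: (congr1 fine (mu_I R)).
rewrite /h; lra.
Qed.

End weierstrass.

(** * Near minimizers of the Szego extremal problem *)

Section evaluation.
Variable R : realType.
Local Notation I := (@I11 R).
Local Notation C := (R[i]%type).
Implicit Types A B T : {poly R}.

Lemma evD A B x : ev (A + B) x = ev A x + ev B x.
Proof. by rewrite /ev rmorphD hornerD. Qed.

Lemma evM A B x : ev (A * B) x = ev A x * ev B x.
Proof. by rewrite /ev rmorphM hornerM. Qed.

Lemma evC (c x : R) : ev c%:P x = real_complex R c.
Proof. by rewrite /ev real_hornerC. Qed.

Lemma evX (x : R) : ev 'X x = zc x.
Proof. by rewrite /ev map_polyX hornerX. Qed.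

Lemma evXn (n : nat) (x : R) : ev 'X^n x = zc x ^+ n.
Proof. by rewrite /ev map_polyXn hornerXn. Qed.

Lemma evZ c A x : ev (c *: A) x = real_complex R c * ev A x.
Proof. by rewrite -mul_polyC evM evC. Qed.

Lemma itg_Re_ev_rho A : itg (fun x => Re (ev A x) * rho x).
Proof. by apply: itgM_rho; case: (bmc_ev A). Qed.

Lemma int_Re_ev_rho_shift A k : intI (fun x => Re (ev (A * 'X^(k.+1)) x) * rho x) = 0.
Proof.
elim/poly_ind: A k => [|A c IH] k.
  by rewrite -[RHS](@int0 R); apply: eq_int => x _; rewrite mul0r /ev rmorph0 horner0 mul0r.
rewrite (@eq_int _ _ (fun x : R => Re (ev (A * 'X^(k.+2)) x) * rho x + c * (Re (ev 'X^(k.+1) x) * rho x))).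
  have i0 := itg_Re_ev_rho 'X^(k.+1).
  rewrite intD; [|exact: itg_Re_ev_rho|exact: itgZ].
  rewrite IH add0r intZ// (@eq_int _ _ (fun x : R => Re (zc x ^+ k.+1) * rho x)) ?int_zcX_rho ?mulr0//.
  by move=> x _; rewrite evXn.
move=> x _; rewrite mulrDl -mulrA -exprS evD [ev (c%:P * _) x]evM evC ReD [X in _ + X]ReM Re_real Im_real.
by ring.
Qed.

Lemma int_Re_ev_rho A : intI (fun x => Re (ev A x) * rho x) = A.[0].
Proof.
elim/poly_ind: A => [|A c _].
  by rewrite horner0 -[RHS](@int0 R); apply: eq_int => x _; rewrite /ev rmorph0 horner0 mul0r.
rewrite (@eq_int _ _ (fun x : R => Re (ev (A * 'X^1) x) * rho x + c * rho x)).
  rewrite intD; [|exact: itg_Re_ev_rho|by apply: itgZ; exact: itg_rho].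
  rewrite int_Re_ev_rho_shift intZ ?int_rho; last exact: itg_rho.
  by rewrite !hornerE.
by move=> x _; rewrite expr1 evD evC ReD Re_real mulrDl.
Qed.

(** Multiplication by [x] is multiplication by [(z + 1/z) / 2]. The factor [1/z] is harmless on the
    multiple of ['X], and a constant term [a] contributes [a Re z]; hence the inner case analysis on
    [A]. *)
Lemma poly_Re_ev T : exists A, forall x, I x -> Re (ev A x) = T.[x].
Proof.
elim/poly_ind: T => [|T c [A HA]].
  by exists 0 => x _; rewrite /ev rmorph0 !horner0.
suff [B HB] : exists B, forall x, I x -> Re (ev B x) = x * Re (ev A x).
  exists (B + c%:P) => x Ix; rewrite evD evC ReD Re_real HB// HA//.
  by rewrite hornerMXaddC mulrC.
elim/poly_ind: A {HA} => [|A a _].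
  by exists 0 => x _; rewrite /ev rmorph0 horner0 mulr0.
exists (2^-1 *: (A * 'X^2 + A) + a *: 'X) => x Ix.
rewrite !evD !evZ !evD !evM evC !evX !ReImE /=.
have := nsq_zc Ix; rewrite /nsq /=; set y := Num.sqrt _ => yE.
have y2 : y * y = 1 - x ^+ 2 by rewrite -expr2; move: yE; lra.
move: (Re (ev A x)) (Im (ev A x)) => p q.
by field: y2.
Qed.

End evaluation.

Section near_minimizers.
Variable R : realType.
Local Notation I := (@I11 R).
Local Notation C := (R[i]%type).
Variable w : R -> R.
Hypothesis w_ge0 : forall x, I x -> 0 <= w x.
Hypothesis w_itg : itg w.
Variable m : R.
Hypothesis m_gt0 : 0 < m.
Hypothesis m_lb : forall A : {poly R}, A.[0] = 1 -> m <= nrm w A.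
Hypothesis m_inf : forall e : R, 0 < e -> exists A : {poly R}, A.[0] = 1 /\ nrm w A <= m + e.
Implicit Types A B T : {poly R}.
Local Notation nrm := (nrm w).
Local Notation ip := (ip w).

Lemma bmf_Re_ev2 A B : bmf (fun x => Re (ev A x * conjc (ev B x))).
Proof. by case: (bmcM (bmc_ev A) (bmcJ (bmc_ev B))). Qed.

Lemma itg_nrm A : itg (fun x => nsq (ev A x) * w x).
Proof. by apply: itgM => //; apply: bmf_nsq; exact: bmc_ev. Qed.

Lemma itg_ip A B : itg (fun x => Re (ev A x * conjc (ev B x)) * w x).
Proof. by apply: itgM => //; exact: bmf_Re_ev2. Qed.

Lemma nrm_ge0 A : 0 <= nrm A.
Proof. by apply: int_ge0 => x Ix; rewrite mulr_ge0 ?nsq_ge0 ?w_ge0. Qed.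

Lemma nrm_ip A : ip A A = nrm A.
Proof. by apply: eq_int => x _; rewrite mulcJE. Qed.

Lemma ipDl A B T : ip (A + B) T = ip A T + ip B T.
Proof.
rewrite -intD; [|exact: itg_ip..]; apply: eq_int => x _.
by rewrite evD mulrDl ReD mulrDl.
Qed.

Lemma ipZl c A T : ip (c *: A) T = c * ip A T.
Proof.
rewrite -intZ; last exact: itg_ip.
by apply: eq_int => x _; rewrite evZ -mulrA [X in X * _]ReM Re_real Im_real mul0r subr0 mulrA.
Qed.

Lemma ipC A B : ip A B = ip B A.
Proof. by apply: eq_int => x _; rewrite !ReM !ReJ !ImJ; ring. Qed.

Lemma nrmDZ A T (t : R) : nrm (A + t *: T) = nrm A + 2 * t * ip A T + t ^+ 2 * nrm T.
Proof.
rewrite -!nrm_ip !ipDl ipZl ![ip _ (A + _)]ipC !ipDl !ipZl (ipC T A); ring.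
Qed.

Lemma nrmZ c A : nrm (c *: A) = c ^+ 2 * nrm A.
Proof. by rewrite -!nrm_ip ipZl ipC ipZl mulrA expr2. Qed.

Lemma nrm_lb A : m * A.[0] ^+ 2 <= nrm A.
Proof.
have [A0|A0] := eqVneq A.[0] 0; first by rewrite A0 expr0n mulr0 nrm_ge0.
have := @m_lb (A.[0]^-1 *: A); rewrite hornerZ mulVf// => /(_ erefl).
by rewrite nrmZ exprVn ler_pdivlMl ?exprn_even_gt0// mulrC.
Qed.

Lemma nrmD_le A B : nrm (A + B) <= 2 * nrm A + 2 * nrm B.
Proof.
rewrite -[A + B]/(A + B) -{1}[B]scale1r nrmDZ.
have := nrm_ge0 (A + (-1) *: B); rewrite nrmDZ; lra.
Qed.

(* Compare [A] with the competitors [A + d T] and [A - d T]. *)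
Lemma near_min_ortho A T d : 0 < d -> A.[0] = 1 -> nrm A <= m + d ^+ 2 -> T.[0] = 0 -> `|ip A T| <= d * (1 + nrm T) / 2.
Proof.
move=> d_gt0 A_1 A_min T0.
have H (t : R) : m <= nrm A + 2 * t * ip A T + t ^+ 2 * nrm T.
  by rewrite -nrmDZ m_lb// hornerD hornerZ T0 mulr0 addr0.
have h1 := H d; have h2 := H (- d); rewrite sqrrN in h2.
have k1 : d * (2 * ip A T) >= d * (- (d * (1 + nrm T))) by move: h1 A_min; rewrite !expr2; lra.
have k2 : d * (2 * ip A T) <= d * (d * (1 + nrm T)) by move: h2 A_min; rewrite !expr2; lra.
rewrite ler_pM2l// in k1; rewrite ler_pM2l// in k2.
by rewrite ler_norml; apply/andP; split; lra.
Qed.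

Variables (A : {poly R}) (d : R).
Hypothesis d_gt0 : 0 < d.
Hypothesis d_le1 : d <= 1.
Hypothesis A_1 : A.[0] = 1.
Hypothesis A_min : nrm A <= m + d ^+ 2.

(** The midpoint of [A] and [B] is a competitor, so the parallelogram law gives
    [nrm (A - B) <= 4 d^2]. Then [||a|^2 - |b|^2| <= |a - b| |a + b|] is split by Young's inequality
    with weight [d], which makes both terms of order [d]. *)
Lemma near_min_L1 B (d' : R) : 0 < d' <= d -> B.[0] = 1 -> nrm B <= m + d' ^+ 2 ->
  intI (fun x => `|(nsq (ev A x) - nsq (ev B x)) * w x|) <= d * (2 * m + 4).
Proof.
move=> /andP[d'0 d'd] B1 Bm.
have d2 : d' ^+ 2 <= d ^+ 2 by rewrite lerXn2r ?nnegrE ?(ltW d'0) ?(ltW d_gt0).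
have half : m <= nrm (2^-1 *: (A + B)).
  by apply: m_lb; rewrite hornerZ hornerD A_1 B1; lra.
have hD := nrmDZ A B 1; have hN := nrmDZ A B (-1); rewrite scale1r in hD.
rewrite nrmZ in half.
have N1 : nrm (A + (-1) *: B) <= 4 * d ^+ 2 by move: half hD hN; rewrite !expr2; move: A_min Bm d2; rewrite !expr2; lra.
have N2 : nrm (A + B) <= 4 * (m + d ^+ 2) by have := nrm_ge0 (A + (-1) *: B); move: hD hN A_min Bm d2; rewrite !expr2; lra.
have i1 := itg_nrm (A + (-1) *: B); have i2 := itg_nrm (A + B).
apply: le_trans (_ : (2 * d)^-1 * nrm (A + (-1) *: B) + d / 2 * nrm (A + B) <= _); last first.
  have e1 : (2 * d)^-1 * nrm (A + (-1) *: B) <= (2 * d)^-1 * (4 * d ^+ 2).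
    by rewrite ler_wpM2l// invr_ge0 mulr_ge0// ltW.
  have e2 : d / 2 * nrm (A + B) <= d / 2 * (4 * (m + d ^+ 2)).
    by rewrite ler_wpM2l// divr_ge0// ltW.
  have e3 : (2 * d)^-1 * (4 * d ^+ 2) = 2 * d by field; rewrite gt_eqF.
  have e4 : d * d ^+ 2 <= d * 1 by rewrite ler_wpM2l ?(ltW d_gt0)// expr_le1// ltW.
  move: e1 e2; rewrite e3; lra.
rewrite -!intZ// -intD; [|exact: itgZ..].
apply: le_int; [|by apply: itgD; exact: itgZ|].
  by apply: itg_abs; apply: itgM => //; apply: bmfB; apply: bmf_nsq; exact: bmc_ev.
move=> x Ix; rewrite normrM (ger0_norm (w_ge0 Ix)) !mulrA -mulrDl ler_wpM2r ?w_ge0//.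
rewrite !evD evZ /nsq !ReImE.
move: (Re (ev A x)) (Im (ev A x)) (Re (ev B x)) (Im (ev B x)) => a1 a2 b1 b2.
have key (s : R) : s ^+ 2 = 1 -> s * (a1 ^+ 2 + a2 ^+ 2 - (b1 ^+ 2 + b2 ^+ 2)) <=
    (2 * d)^-1 * ((a1 - b1) ^+ 2 + (a2 - b2) ^+ 2) + d / 2 * ((a1 + b1) ^+ 2 + (a2 + b2) ^+ 2).
  move=> s2; rewrite -subr_ge0.
  have -> : (2 * d)^-1 * ((a1 - b1) ^+ 2 + (a2 - b2) ^+ 2) + d / 2 * ((a1 + b1) ^+ 2 + (a2 + b2) ^+ 2)
      - s * (a1 ^+ 2 + a2 ^+ 2 - (b1 ^+ 2 + b2 ^+ 2)) =
      (2 * d)^-1 * (((a1 - b1) - s * d * (a1 + b1)) ^+ 2 + ((a2 - b2) - s * d * (a2 + b2)) ^+ 2).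
    by field: s2; rewrite gt_eqF.
  by rewrite mulr_ge0 ?invr_ge0 ?addr_ge0 ?sqr_ge0// mulr_ge0// ltW.
have k1 := key 1 (expr1n _ _); have k2 := key (-1) (etrans (sqrrN _) (expr1n _ _)).
rewrite ler_norml; apply/andP; split; move: k1 k2; rewrite ?mul0r ?subr0 ?mulN1r ?mul1r; lra.
Qed.

(* The moments of [|A|^2 w] are read off a much better near minimizer [B], which is
   [L^1]-close to [A] independently of the test polynomial. *)
Lemma near_min_L1_arcsine : intI (fun x => `|nsq (ev A x) * w x - m * rho x|) <= d * (2 * m + 4).
Proof.
have iR := @itg_rho R; have iA := itg_nrm A.
apply: L1_norm_le_poly_test; first by apply: itgB => //; exact: itgZ.
move=> T T1; have [t Ht] := poly_Re_ev T.
apply/ler_addgt0Pr => e e0.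
have [_ [K HK]] := bmf_nsq (bmc_ev (t - t.[0]%:P)).
have K0 : 0 <= K.
  by apply: le_trans (normr_ge0 _) (HK 0 _); apply/I11E; apply/andP; split; lra.
(* The error caused by [B] is at most [d' |t(0)| + d' (1 + K (m + 1)) / 2], hence below
   [d' c <= e]. *)
pose c := `|t.[0]| + (1 + K * (m + 1)) / 2 + 1.
have c0 : 0 < c by rewrite ltr_wpDl// addr_ge0// divr_ge0// addr_ge0// mulr_ge0// addr_ge0// ltW.
pose d' := Order.min d (e / c).
have d'0 : 0 < d' by rewrite lt_min d_gt0 divr_gt0.
have d'd : d' <= d by rewrite ge_min lexx.
have d'c : d' * c <= e by rewrite -ler_pdivlMr// ge_min lexx orbT.
have d'1 : d' ^+ 2 <= d'.
  by rewrite expr2 ler_piMl ?(ltW d'0)// (le_trans d'd).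
have [B [B1 Bm]] := m_inf (exprn_gt0 2 d'0).
have bT : bmf (fun x => T.[x]) by apply: bmf_horner; exact: bmf_id.
have iB := itg_nrm B.
have iAB : itg (fun x => `|(nsq (ev A x) - nsq (ev B x)) * w x|).
  by apply: itg_abs; apply: itgM => //; apply: bmfB; apply: bmf_nsq; exact: bmc_ev.
have step1 : intI (fun x => T.[x] * (nsq (ev A x) * w x - m * rho x)) <=
   intI (fun x => `|(nsq (ev A x) - nsq (ev B x)) * w x| + (T.[x] * (nsq (ev B x) * w x) - m * (T.[x] * rho x))).
  apply: le_int.
  - by apply: itgM => //; apply: itgB => //; exact: itgZ.
  - by apply: itgD => //; apply: itgB; [exact: itgM|apply: itgZ; exact: itgM].
  - move=> x Ix; rewrite -subr_ge0.
    have : T.[x] * ((nsq (ev A x) - nsq (ev B x)) * w x) <= `|(nsq (ev A x) - nsq (ev B x)) * w x|.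
      by apply: le_trans (ler_norm _) _; rewrite normrM ler_piMl// T1.
    lra.
apply: le_trans step1 _.
have iTB : itg (fun x => T.[x] * (nsq (ev B x) * w x)) by exact: itgM.
have iTr : itg (fun x => T.[x] * rho x) by exact: itgM.
rewrite intD//; last by apply: itgB => //; exact: itgZ.
have d'dd : 0 < d' <= d by rewrite d'0.
apply: lerD; first exact: near_min_L1 d'dd B1 Bm.
rewrite intB//; last exact: itgZ.
rewrite intZ//.
have -> : intI (fun x => T.[x] * rho x) = t.[0].
  by rewrite -int_Re_ev_rho; apply: eq_int => x Ix; rewrite Ht.
have -> : intI (fun x => T.[x] * (nsq (ev B x) * w x)) = ip (t * B) B.
  apply: eq_int => x Ix; rewrite -Ht// evM -mulrA mulcJE [in RHS]ReM Re_real Im_real.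
  by rewrite mulr0 subr0 mulrA.
(* As [t(0)] is the integral of [T] against [rho], the moment must be close to [t(0) m]. The part
   [t(0) B] gives this, and [q B] vanishes at 0, so it is nearly orthogonal to [B]. *)
pose q := t - t.[0]%:P.
have -> : t * B = t.[0] *: B + q * B by rewrite /q mulrBl mul_polyC subrKC.
rewrite ipDl ipZl nrm_ip.
have qB0 : (q * B).[0] = 0 by rewrite hornerM /q hornerD hornerN hornerC subrr mul0r.
have h1 := near_min_ortho d'0 B1 Bm qB0; rewrite ipC in h1.
have h2 : nrm (q * B) <= K * nrm B.
  rewrite -intZ//; apply: le_int; [exact: itg_nrm|exact: itgZ|move=> x Ix].
  rewrite evM nsqM -mulrA ler_wpM2r ?mulr_ge0 ?nsq_ge0 ?w_ge0//.
  exact: le_trans (ler_norm _) (HK x Ix).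
have h3 : K * nrm B <= K * (m + 1).
  by rewrite ler_wpM2l//; move: Bm d'1 (le_trans d'd d_le1); lra.
have h4 : t.[0] * (nrm B - m) <= `|t.[0]| * d'.
  apply: le_trans (ler_norm _) _; rewrite normrM ler_wpM2l// ger0_norm ?subr_ge0 ?m_lb//.
  by move: Bm d'1; lra.
have h5 : d' * (1 + nrm (q * B)) <= d' * (1 + K * (m + 1)).
  by rewrite ler_wpM2l ?(ltW d'0)//; move: h2 h3; lra.
move: h1; rewrite ler_norml => /andP[_ h1].
by move: h1 h4 h5 d'c d'0; rewrite /c; lra.
Qed.

End near_minimizers.

(** * Chebyshev polynomials and passage between [x] and [z] *)

Section chebyshev.
Variable R : realType.
Local Notation I := (@I11 R).
Local Notation C := (R[i]%type).
Implicit Types A S : {poly R}.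

Lemma Re_exprSS (u : C) k : Re (u ^+ k.+2) = 2 * Re u * Re (u ^+ k.+1) - nsq u * Re (u ^+ k).
Proof. by rewrite !exprS !ReImE /nsq; ring. Qed.

(** The Chebyshev polynomials of the first kind. Their recurrence has two terms, so two consecutive
    ones are built together; the truncated predecessor [k.-1] also gives the right coefficient at
    [k = 0]. *)
Lemma chebyshev_poly (k : nat) : exists T : {poly R},
  [/\ (size T <= k.+1)%N, T`_k = 2 ^+ k.-1 & forall x, I x -> T.[x] = Re (zc x ^+ k)].
Proof.
suff [] : (exists T : {poly R},
  [/\ (size T <= k.+1)%N, T`_k = 2 ^+ k.-1 & forall x, I x -> T.[x] = Re (zc x ^+ k)]) /\
  (exists T : {poly R},
  [/\ (size T <= k.+2)%N, T`_k.+1 = 2 ^+ k & forall x, I x -> T.[x] = Re (zc x ^+ k.+1)]) by [].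
elim: k => [|k [[T [T1 T2 T3]] [U [U1 U2 U3]]]].
  split; first by exists 1; split; [rewrite size_poly1|rewrite coef1|move=> x _; rewrite hornerC].
  by exists 'X; split; [rewrite size_polyX|rewrite coefX|move=> x _; rewrite hornerX expr1].
split; first by exists U.
exists (2 *: ('X * U) - T); split.
- apply: leq_trans (size_polyD _ _) _; rewrite geq_max size_polyN; apply/andP; split.
    apply: leq_trans (size_scale_leq _ _) _; rewrite mulrC.
    have [->|U0] := eqVneq U 0; first by rewrite mul0r size_poly0.
    by rewrite size_mulX.
  by apply: leq_trans T1 _; lia.
- rewrite coefB coefZ coefXM /= U2 exprS [T`__]nth_default ?subr0//.
  by apply: leq_trans T1 _; lia.
- move=> x Ix; rewrite hornerD hornerN hornerZ hornerM hornerX U3// T3//.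
  by rewrite Re_exprSS nsq_zc// mul1r mulrA.
Qed.

Lemma ev_coef A n x : (size A <= n)%N -> ev A x = \sum_(k < n) real_complex R A`_k * zc x ^+ k.
Proof.
move=> An; rewrite /ev (@horner_coef_wide _ n) ?size_map_poly//.
by apply: eq_bigr => k _; rewrite coef_map.
Qed.

Lemma conjc_sum n (F : nat -> C) : conjc (\sum_(k < n) F k) = \sum_(k < n) conjc (F k).
Proof. exact: rmorph_sum. Qed.

Lemma Re_sum n (F : nat -> C) : Re (\sum_(k < n) F k) = \sum_(k < n) Re (F k).
Proof.
by elim: n => [|n IH]; [rewrite !big_ord0|rewrite !big_ord_recr ReD -IH].
Qed.

Lemma zcXB (i j : nat) x : I x -> (j <= i)%N -> zc x ^+ i * conjc (zc x ^+ j) = zc x ^+ (i - j).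
Proof.
move=> Ix ji; rewrite -{1}(subnK ji) exprD -mulrA mulcJE nsqX nsq_zc// expr1n.
by rewrite real_complex1 mulr1.
Qed.

Lemma zcXn_conj_ev A n N x : I x -> (size A <= n)%N -> (n <= N)%N ->
  zc x ^+ N * conjc (ev A x) = \sum_(k < n) real_complex R A`_k * zc x ^+ (N - k).
Proof.
move=> Ix An nN; rewrite (ev_coef _ An) (@conjc_sum n (fun k => real_complex R A`_k * zc x ^+ k)).
rewrite mulr_sumr; apply: eq_bigr => k _.
rewrite conjcM conjc_real mulrCA zcXB//.
exact: leq_trans (ltnW (ltn_ord k)) nN.
Qed.

(** The expected profile of [p_n] is itself a polynomial of degree [n] in [x], a sum of Chebyshev
    polynomials. Orthonormality then computes its product with [p_n] from the leading coefficient
    alone. *)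
Lemma Re_zcXn_conj_poly A n : (0 < n)%N -> (size A <= n)%N -> exists Q : {poly R},
  [/\ (size Q <= n.+1)%N, Q`_n = 2 ^+ n.-1 * A.[0] &
      forall x, I x -> Q.[x] = Re (zc x ^+ n * conjc (ev A x))].
Proof.
move=> n0 An; have /choice[T HT] := chebyshev_poly.
exists (\sum_(k < n) A`_k *: T (n - k)%N); split.
- apply: leq_trans (size_sum _ _ _) _; apply/bigmax_leqP => k _.
  apply: leq_trans (size_scale_leq _ _) _; case: (HT (n - k)%N) => + _ _.
  by move=> /leq_trans; apply; rewrite ltnS leq_subr.
- rewrite coef_sum; case: n n0 An => // n _ An.
  rewrite big_ord_recl /= subn0 coefZ; case: (HT n.+1) => _ -> _.
  rewrite big1 ?addr0 ?horner_coef0 1?mulrC// => k _.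
  rewrite coefZ [X in _ * X]nth_default ?mulr0//; have [h _ _] := HT (n.+1 - bump 0 k)%N.
  by apply: leq_trans h _; rewrite /bump; lia.
- move=> x Ix; rewrite (zcXn_conj_ev Ix An (leqnn n)).
  rewrite (@Re_sum n (fun k => real_complex R A`_k * zc x ^+ (n - k))) horner_sum.
  apply: eq_bigr => k _; rewrite hornerZ; case: (HT (n - k)%N) => _ _ ->//.
  by rewrite ReM Re_real Im_real mul0r subr0.
Qed.

(** Serves the oscillating half of [Q^2]: its integral becomes [ip B A], which is small because [B]
    vanishes at 0. *)
Lemma conj_ev_shift_poly A n : (size A <= n)%N -> exists B : {poly R},
  B.[0] = 0 /\ forall x, I x -> ev B x = zc x ^+ (n + n) * conjc (ev A x).
Proof.
move=> An; exists (\sum_(k < n) A`_k *: 'X^(n + n - k)); split.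
  rewrite horner_sum big1// => k _; rewrite hornerZ hornerXn expr0n.
  have -> : (n + n - k == 0)%N = false by have := ltn_ord k; lia.
  by rewrite mulr0.
move=> x Ix; rewrite (zcXn_conj_ev Ix An (leq_addr n n)).
rewrite /ev rmorph_sum horner_sum; apply: eq_bigr => k _.
by rewrite -[LHS]/(ev _ x) evZ evXn.
Qed.

(** As [x z = (z^2 + 1) / 2], the factor [z^n] absorbs all negative powers, and the top coefficient
    reaches the constant term with one factor [1/2] per degree. So [p_n] enters the extremal
    problem, its leading coefficient becoming a value at 0. *)
Lemma zcXn_poly S n : (size S <= n.+1)%N -> exists P : {poly R},
  P.[0] = S`_n / 2 ^+ n /\ forall x, I x -> ev P x = zc x ^+ n * real_complex R S.[x].
Proof.
elim: n S => [|n IH] S Sn.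
  exists S; rewrite horner_coef0 expr0 divr1; split=> // x _.
  by rewrite (size1_polyC Sn) evC hornerC expr0 mul1r.
elim/poly_ind: S Sn => [_|S c _ Sn].
  exists 0; rewrite coef0 mul0r horner0; split=> // x _.
  by rewrite /ev rmorph0 !horner0 rmorph0 mulr0.
have Sn1 : (size S <= n.+1)%N.
  have [->|S0] := eqVneq S 0; first by rewrite size_poly0.
  by move: Sn; rewrite size_MXaddC (negbTE S0).
have [P [P0 HP]] := IH S Sn1.
exists (P * (2^-1 *: ('X * 'X + 1)) + c *: 'X^(n.+1)); split.
  have -> : (S * 'X + c%:P)`_n.+1 = S`_n by rewrite coefD coefMX coefC /= addr0.
  rewrite hornerD hornerM !hornerZ hornerXn expr0n /= mulr0 addr0 P0 hornerD hornerM hornerX hornerC.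
  by rewrite exprS mul0r add0r invfM; ring.
move=> x Ix; rewrite evD evM HP// !evZ evD evM evX evXn evC real_complex1 hornerMXaddC.
rewrite rmorphD rmorphM /=.
have zx : real_complex R 2^-1 * (zc x * zc x + 1) = zc x * real_complex R x.
  have <- : zc x * conjc (zc x) = 1 by rewrite mulcJE nsq_zc.
  rewrite -mulrDr mulrCA; congr (_ * _).
  by apply/eqP; rewrite eq_complex !ReImE /=; apply/andP; split; apply/eqP; field.
by rewrite zx exprS; ring.
Qed.

End chebyshev.

(** * [L^2] asymptotics of the orthonormal polynomials *)

Section szego_asymptotics.
Variable R : realType.
Local Notation I := (@I11 R).
Local Notation C := (R[i]%type).
Variable w : R -> R.
Hypothesis w_ge0 : forall x, I x -> 0 <= w x.
Hypothesis w_itg : itg w.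
Variable p : nat -> {poly R}.
Hypothesis p_on : orthonormal_polys w p.
Implicit Types A S : {poly R}.

Lemma Re_realM (r : R) (z : C) : Re (real_complex R r * z) = r * Re z.
Proof. by rewrite ReM Re_real Im_real mul0r subr0. Qed.

Lemma bmf_poly S : bmf (fun x => S.[x]).
Proof. by apply: bmf_horner; exact: bmf_id. Qed.

Lemma itg_poly_w S : itg (fun x => S.[x] * w x).
Proof. by apply: itgM => //; exact: bmf_poly. Qed.

Definition lin S : R := intI (fun x => S.[x] * w x).

Lemma linD S T : lin (S + T) = lin S + lin T.
Proof.
rewrite -intD; [|exact: itg_poly_w..]; apply: eq_int => x _.
by rewrite hornerD mulrDl.
Qed.

Lemma linZ c S : lin (c *: S) = c * lin S.
Proof.
rewrite -intZ; last exact: itg_poly_w.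
by apply: eq_int => x _; rewrite hornerZ mulrA.
Qed.

Lemma p_ortho i j : lin (p i * p j) = (i == j)%:R.
Proof.
case: p_on => _ /(_ i j) H.
have : (intI (fun x => (p j).[x] * (p i).[x] * w x))%:E = (if i == j then 1 else 0)%:E :> \bar R.
  rewrite -int_EFin//; apply: (eq_itg _ (itg_poly_w (p j * p i))).
  by move=> x _; rewrite hornerM.
move=> [E]; rewrite /lin (@eq_int _ _ (fun x => (p j).[x] * (p i).[x] * w x)).
  by rewrite E; case: eqP.
by move=> x _; rewrite hornerM (mulrC (_.[x])).
Qed.

Lemma size_p n : size (p n) = n.+1. Proof. by case: p_on => /(_ n)[]. Qed.
Lemma lead_p_gt0 n : 0 < lead_coef (p n). Proof. by case: p_on => /(_ n)[]. Qed.

Lemma p_coef n : (p n)`_n = lead_coef (p n).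
Proof. by rewrite lead_coefE size_p. Qed.

Lemma size_sub_lead S n : (size S <= n.+1)%N ->
  (size (S - (S`_n / lead_coef (p n)) *: p n)%R <= n)%N.
Proof.
move=> Sn; apply/leq_sizeP => j nj; rewrite coefB coefZ.
move: nj; rewrite leq_eqVlt => /predU1P[<-|nj].
  by rewrite p_coef mulfVK ?subrr// gt_eqF// lead_p_gt0.
rewrite [X in X - _]nth_default ?(leq_trans Sn)// [X in _ * X]nth_default ?size_p//.
by rewrite mulr0 subr0.
Qed.

Lemma p_ortho_lower S n : (size S <= n)%N -> lin (p n * S) = 0.
Proof.
suff H : forall k S, (k <= n)%N -> (size S <= k)%N -> lin (p n * S) = 0 by exact: H.
elim=> [|k IH] {}S kn Sk.
  have -> : S = 0 by apply/eqP; rewrite -size_poly_eq0 -leqn0.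
  by rewrite mulr0 -(scale0r (0 : {poly R})) linZ mul0r.
rewrite -[S](subrK ((S`_k / lead_coef (p k)) *: p k)) mulrDr linD IH ?size_sub_lead//; last exact: ltnW.
by rewrite -scalerAr linZ p_ortho gtn_eqF// mulr0 addr0.
Qed.

Lemma p_ortho_lead S n : (size S <= n.+1)%N -> lin (p n * S) = S`_n / lead_coef (p n).
Proof.
move=> Sn; rewrite -{1}[S](subrK ((S`_n / lead_coef (p n)) *: p n)) mulrDr linD.
rewrite p_ortho_lower ?size_sub_lead// add0r -scalerAr linZ p_ortho eqxx mulr1//.
Qed.

Variable m : R.
Hypothesis m_gt0 : 0 < m.
Hypothesis m_lb : forall A : {poly R}, A.[0] = 1 -> m <= nrm w A.
Variables (A : {poly R}) (d : R).
Hypothesis d_gt0 : 0 < d.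
Hypothesis d_le1 : d <= 1.
Hypothesis A_1 : A.[0] = 1.
Hypothesis A_min : nrm w A <= m + d ^+ 2.

(** Per unit of [d]: the first summand is twice the loss in the lower bound 1 for [c X], where
    [c = sqrt (2 / m)]; the second is the excess of [c^2 lin (Q * Q)] over 1. *)
Definition szego_cst : R := 2 * ((5 + 2 / m) / 2 * Num.sqrt (2 / m)) + 2 / m * (2^-1 + (2 + m) / 4).

(* Expanding the square, everything reduces to the lower bound [X >= y m - O(d)] for
   [X = intI p_n Q w] and [2 X y = 1], where [y = lead_coef p_n / 2^n]. *)
Lemma szego_asymptotics n : (size A <= n)%N ->
  intI (fun x => ((p n).[x] - Num.sqrt (2 / m) * Re (zc x ^+ n * conjc (ev A x))) ^+ 2 * w x)
  <= d * szego_cst.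
Proof.
move=> An.
have n0 : (0 < n)%N.
  rewrite lt0n; apply/eqP => n0; move: An; rewrite n0 leqn0 size_poly_eq0 => /eqP A0.
  by move/eqP: A_1; rewrite A0 horner0 eq_sym oner_eq0.
have [Q [Qs Qn QE]] := Re_zcXn_conj_poly n0 An.
have [P [P0 PE]] := zcXn_poly (eq_leq (size_p n)).
have [B [B0 BE]] := conj_ev_shift_poly An.
set c := Num.sqrt (2 / m).
have c0 : 0 < c by rewrite sqrtr_gt0 divr_gt0.
have c2 : c ^+ 2 = 2 / m by rewrite sqr_sqrtr// divr_ge0// ltW.
pose y := lead_coef (p n) / 2 ^+ n.
have y0 : 0 < y by rewrite divr_gt0 ?lead_p_gt0 ?exprn_gt0.
pose X := lin (p n * Q).
have XE : 2 * X * y = 1.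
  rewrite /X p_ortho_lead// Qn A_1 mulr1 /y; case: (n) n0 => // k _ /=.
  have : lead_coef (p k.+1) != 0 by rewrite gt_eqF ?lead_p_gt0.
  have : (2 : R) ^+ k != 0 by rewrite expf_neq0.
  rewrite exprS; move: ((2 : R) ^+ k) (lead_coef _) => a b a0 b0.
  by field; rewrite a0 b0.
have X0 : 0 < X by have : 0 < 2 * X * y; [rewrite XE|rewrite pmulr_lgt0//; lra].
have PA : ip w P A = X.
  apply: eq_int => x Ix; rewrite hornerM QE// PE//; congr (_ * _).
  by rewrite -mulrA mulrCA Re_realM.
have PN : nrm w P = 1.
  have <- : lin (p n * p n) = 1 by rewrite p_ortho eqxx.
  apply: eq_int => x Ix; rewrite PE// nsqM nsqX nsq_zc// expr1n mul1r hornerM.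
  by rewrite /nsq /= expr0n addr0 expr2.
(* By near-orthogonality to [A] of what vanishes at 0, [X = ip P A] is close to [y nrm A]. *)
have C0 : (P + (- y) *: A).[0] = 0.
  by rewrite hornerD hornerZ P0 A_1 mulr1 p_coef -/y subrr.
have y2m : y ^+ 2 * m <= 1.
  have := nrm_lb w_ge0 w_itg m_lb P; rewrite PN P0 p_coef -/y mulrC; exact.
have NA1 : nrm w A <= m + 1 by move: A_min; have : d ^+ 2 <= 1; [rewrite expr_le1// ltW|lra].
have NAm : m <= nrm w A by exact: m_lb.
have y2NA : y ^+ 2 * nrm w A <= 1 + m^-1.
  apply: le_trans (ler_wpM2l (sqr_ge0 y) NA1) _; rewrite mulrDr mulr1; apply: lerD => //.
  by rewrite -[leRHS]mul1r ler_pdivlMr.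
have NC : nrm w (P + (- y) *: A) <= 4 + 2 / m.
  apply: le_trans (nrmD_le w_ge0 w_itg _ _) _; rewrite PN nrmZ// sqrrN.
  by move: y2NA; lra.
have hC := near_min_ortho w_itg m_lb d_gt0 A_1 A_min C0.
have E : ip w A (P + (- y) *: A) = X - y * nrm w A.
  by rewrite ipC ipDl// ipZl// PA nrm_ip mulNr.
rewrite E in hC.
set K1 := (5 + 2 / m) / 2.
have XK : y * m - d * K1 <= X.
  move: hC; rewrite ler_norml => /andP[hC _].
  have h1 : y * m <= y * nrm w A by rewrite ler_wpM2l ?(ltW y0).
  have h2 : d * (1 + nrm w (P + (- y) *: A)) <= d * (5 + 2 / m).
    by rewrite ler_wpM2l ?(ltW d_gt0)//; lra.
  rewrite /K1; move: h1 h2 hC; lra.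
(* Multiplying [XK] by [X] and using [2 X y = 1] eliminates [y]: what remains is a quadratic
   inequality in [v], which forces [v] to be at least [1 - O(d)]. *)
pose v := c * X.
have v0 : 0 < v by rewrite mulr_gt0.
have K10 : 0 <= K1 by rewrite divr_ge0// addr_ge0// divr_ge0// ltW.
have v2 : 1 - d * (K1 * c) * v <= v ^+ 2.
  have h := ler_wpM2l (ltW X0) XK.
  have XX : X * (y * m) = m / 2.
    have -> : X * (y * m) = 2 * X * y * (m / 2) by field.
    by rewrite XE mul1r.
  have -> : v ^+ 2 = 2 / m * (X * X) by rewrite /v exprMn c2 expr2.
  have -> : d * (K1 * c) * v = 2 / m * (X * (d * K1)).
    by rewrite /v -c2; ring.
  have h2m : 0 <= 2 / m by rewrite divr_ge0// ltW.
  have -> : 1 - 2 / m * (X * (d * K1)) = 2 / m * (X * (y * m - d * K1)).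
    by rewrite (mulrBr X) XX; field; rewrite gt_eqF.
  by have := ler_wpM2l h2m h.
have v1 : 1 - d * (K1 * c) <= v.
  have [v1|v1] := lerP 1 v.
    by apply: le_trans v1; rewrite lerBlDr lerDl mulr_ge0 ?(ltW d_gt0)// mulr_ge0// ltW.
  have vv : v ^+ 2 <= v by rewrite expr2 ler_piMl// ltW.
  have : d * (K1 * c) * v <= d * (K1 * c) * 1.
    by rewrite ler_wpM2l ?(ltW v1)// mulr_ge0 ?(ltW d_gt0)// mulr_ge0// ltW.
  move: v2 vv; lra.
have NB : nrm w B = nrm w A.
  by apply: eq_int => x Ix; rewrite BE// nsqM nsqX nsq_zc// expr1n mul1r nsqJ.
(* This is [(Re u)^2 = (|u|^2 + Re (u^2)) / 2] for [u = z^n conj A(z)]. *)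
have QQ : lin (Q * Q) = 2^-1 * nrm w A + 2^-1 * ip w B A.
  rewrite -!intZ; [|exact: itg_ip|exact: itg_nrm].
  rewrite -intD; [|by apply: itgZ; exact: itg_nrm|by apply: itgZ; exact: itg_ip].
  apply: eq_int => x Ix; rewrite hornerM !QE// BE//.
  set u := zc x ^+ n * conjc (ev A x).
  have -> : zc x ^+ (n + n) * conjc (ev A x) * conjc (ev A x) = u * u.
    by rewrite /u exprD; ring.
  have -> : nsq (ev A x) = nsq u by rewrite /u nsqM nsqX nsq_zc// expr1n mul1r nsqJ.
  by rewrite ReM /nsq; field.
have hB := near_min_ortho w_itg m_lb d_gt0 A_1 A_min B0.
rewrite ipC NB in hB.
have QQle : lin (Q * Q) <= m / 2 + d * (2^-1 + (2 + m) / 4).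
  rewrite QQ; move: hB; rewrite ler_norml => /andP[_ hB].
  have dd : d ^+ 2 <= d by rewrite expr2 ler_piMl ?(ltW d_gt0).
  have : d * (1 + nrm w A) <= d * (2 + m) by rewrite ler_wpM2l ?(ltW d_gt0)//; lra.
  by move: dd hB A_min; lra.
have -> : intI (fun x => ((p n).[x] - c * Re (zc x ^+ n * conjc (ev A x))) ^+ 2 * w x) =
    lin (p n * p n + ((- (2 * c)) *: (p n * Q) + c ^+ 2 *: (Q * Q))).
  by apply: eq_int => x Ix; rewrite !(hornerD, hornerZ, hornerM) QE//; ring.
rewrite !linD !linZ p_ortho eqxx -/X c2.
have := ler_wpM2l (_ : 0 <= 2 / m) QQle; rewrite divr_ge0 ?(ltW m_gt0)// => /(_ isT).
have -> : 2 / m * (m / 2 + d * (2^-1 + (2 + m) / 4)) = 1 + d * (2 / m * (2^-1 + (2 + m) / 4)).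
  by field; rewrite gt_eqF.
rewrite /szego_cst -/K1 -/c; move: v1; rewrite /v; set QQ' := 2 / m * lin _.
set M' := 2 / m * (_ + _); move: K1 {K10 XK v2} => K1 h1 h2; rewrite mulr1n; lra.
Qed.

End szego_asymptotics.

(** * Oscillating phases *)

Section oscillation.
Variable R : realType.
Local Notation I := (@I11 R).
Local Notation C := (R[i]%type).

(** For [|u| = 1] and [a = 1 + Re u], [2 a = |1 + u|^2] while the regularized argument is
    [|1 + t u|^2]. The factor [a] tames the logarithm at [u = -1], so the cost is of order [1 - t]
    uniformly. *)
Lemma xlnx_approx (a t : R) : 0 <= a <= 2 -> 2^-1 <= t < 1 ->
  `|a * ln a - a * (ln ((1 - t) ^+ 2 + 2 * t * a) - ln 2)| <= 4 * (1 - t).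
Proof.
move=> /andP[a0 a2] /andP[t1 t2]; have t0 : 0 < t by lra.
move: a0; rewrite le_eqVlt => /predU1P[<-|a0].
  by rewrite !mul0r subrr normr0; lra.
set b := (1 - t) ^+ 2 + 2 * t * a.
have sq0 := sqr_ge0 (1 - t).
have ta : 0 < 2 * t * a by rewrite !mulr_gt0.
have b0 : 0 < b by rewrite ltr_wpDl.
have l2a : ln (2 * a) = ln 2 + ln a by rewrite lnM ?posrE.
have up : a * (ln b - ln (2 * a)) <= (b - 2 * a) / 2.
  have a20 : 0 < 2 * a by rewrite mulr_gt0.
  have := exp_tangent a20 b0; lra.
have lo : - (2 * (1 - t)) <= ln t.
  have := exp_tangent t0 (ltr01 : 0 < (1 : R)); rewrite ln1 addr0.
  have : t * (2 * (1 - t)) >= 1 * (1 - t).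
    by rewrite mulrA ler_wpM2r; lra.
  move=> h1 h2; rewrite lerNl -(ler_pM2l t0); lra.
have lb : ln t + ln (2 * a) <= ln b.
  rewrite -lnM ?posrE ?mulr_gt0// ler_ln ?posrE ?mulr_gt0// /b; lra.
have lo2 : - (4 * (1 - t)) <= a * (ln b - ln (2 * a)).
  apply: le_trans (_ : a * ln t <= _); last by rewrite ler_pM2l//; lra.
  have h := ler_wpM2l (ltW a0) lo.
  have : a * (2 * (1 - t)) <= 2 * (2 * (1 - t)) by rewrite ler_wpM2r; lra.
  lra.
have -> : a * ln a - a * (ln b - ln 2) = - (a * (ln b - ln (2 * a))) by rewrite l2a; ring.
rewrite normrN ler_norml lo2 /=; apply: le_trans up _; rewrite /b.
have : (1 - t) ^+ 2 <= 1 * (1 - t) by rewrite expr2 ler_wpM2r; lra.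
have : (1 - t) * a >= 0 by rewrite mulr_ge0 ?ltW; lra.
lra.
Qed.

Variable s : R -> C.
Hypothesis bs : bmc s.
Hypothesis s1 : forall x, I x -> nsq (s x) = 1.

Lemma real_complexX (a : R) k : real_complex R (a ^+ k) = real_complex R a ^+ k.
Proof. exact: rmorphXn. Qed.

Definition osc (n : nat) (x : R) : C := (zc x ^+ n * conjc (s x)) ^+ 2.

Lemma bmc_osc n : bmc (osc n).
Proof. by apply: bmcX; apply: bmcM; [apply: bmcX; exact: bmc_zc|exact: bmcJ]. Qed.

Lemma nsq_osc n x : I x -> nsq (osc n x) = 1.
Proof. by move=> Ix; rewrite nsqX nsqM nsqX nsq_zc// nsqJ s1// !expr1n mul1r expr1n. Qed.

Let r k n := intI (fun x => Re (osc n x ^+ k) * rho x).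

Let itg_r k n : itg (fun x => Re (osc n x ^+ k) * rho x).
Proof. by apply: itgM_rho; case: (bmcX k (bmc_osc n)). Qed.

Let r_cvg k : (r k) @ \oo --> ((k == 0%N)%:R : R).
Proof.
case: k => [|k].
  rewrite (_ : r 0%N = fun=> 1); first exact: cvg_cst.
  apply/funext => n; rewrite /r -[RHS](int_rho R); apply: eq_int => x _.
  by rewrite expr0 /= mul1r.
(* A power [k] of [osc n] is [z^(2 k n)] times a fixed bounded function, so its integrals form a
   subsequence of those in [riemann_lebesgue]. *)
have h := riemann_lebesgue (bmcX (2 * k.+1) (bmcJ bs)).
have sub : (fun n => (n * (2 * k.+1))%N) @ \oo --> \oo.
  move=> A [N _ HN]; exists N => // n /= Nn; apply: HN => /=; nia.
have := cvg_comp _ _ sub h; rewrite (_ : _ \o _ = r k.+1) //.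
apply/funext => n; apply: eq_int => x _ /=.
by rewrite /osc -exprM exprMn -exprM.
Qed.

Lemma cvg_sum_nat (N : nat) (f : nat -> nat -> R) (l : nat -> R) :
  (forall k, f k @ \oo --> l k) -> (fun n => \sum_(k < N) f k n) @ \oo --> \sum_(k < N) l k.
Proof.
move=> fl; elim: N => [|N IH].
  rewrite big_ord0 (_ : (fun _ => _) = fun=> 0); first exact: cvg_cst.
  by apply/funext => n; rewrite big_ord0.
rewrite big_ord_recr /= (_ : (fun _ => _) = fun n => \sum_(k < N) f k n + f N n).
  exact: cvgD.
by apply/funext => n; rewrite big_ord_recr.
Qed.

Let approx (t : R) (N n : nat) (x : R) : R :=
  (1 + Re (osc n x)) * (- 2 * (\sum_(k < N) Re ((real_complex R (- t) * osc n x) ^+ k.+1) / k.+1%:R) - ln 2).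

(** The products are linearized by [2 Re u Re (u^(k+1)) = Re (u^(k+2)) + Re (u^k)], valid for
    [|u| = 1]. *)
Let approx_itg t N n : itg (fun x => approx t N n x * rho x) /\
  intI (fun x => approx t N n x * rho x) =
  \sum_(k < N) (- 2 * (- t) ^+ k.+1 / k.+1%:R) * (r k.+1 n + 2^-1 * (r k.+2 n + r k n)) - ln 2 * (1 + r 1%N n).
Proof.
pose F k x := (- 2 * (- t) ^+ k.+1 / k.+1%:R) * (Re (osc n x ^+ k.+1) * rho x
  + 2^-1 * (Re (osc n x ^+ k.+2) * rho x + Re (osc n x ^+ k) * rho x)).
have iF2 k : itg (fun x => 2^-1 * (Re (osc n x ^+ k.+2) * rho x + Re (osc n x ^+ k) * rho x)).
  by apply: itgZ; exact: itgD.
have iF k : itg (F k) by apply: itgZ; exact: itgD.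
have iL : itg (fun x => ln 2 * (rho x + Re (osc n x ^+ 1) * rho x)).
  by apply: itgZ; apply: itgD => //; exact: itg_rho.
have iS : itg (fun x => \sum_(k <- iota 0 N) F k x) by exact: itg_sum.
have E x : I x -> \sum_(k <- iota 0 N) F k x - ln 2 * (rho x + Re (osc n x ^+ 1) * rho x) = approx t N n x * rho x.
  move=> Ix; rewrite /approx expr1.
  have -> : \sum_(k <- iota 0 N) F k x = - 2 * (1 + Re (osc n x)) * (\sum_(k < N) Re ((real_complex R (- t) * osc n x) ^+ k.+1) / k.+1%:R) * rho x.
    rewrite -{1}[N]subn0 -/(index_iota 0 N) big_mkord mulr_sumr mulr_suml.
    apply: eq_bigr => k _; rewrite /F Re_exprSS nsq_osc// (exprMn _ (real_complex R (- t))) -real_complexX Re_realM.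
    by move: (Re (osc n x ^+ k.+1)) (k.+1%:R^-1 : R) => q kk; field.
  ring.
split; first by apply: (eq_itg E); exact: itgB.
rewrite -(eq_int E) intB// int_sum// intZ; last by apply: itgD => //; exact: itg_rho.
rewrite intD ?int_rho//; last exact: itg_rho.
congr (_ - _); rewrite -{1}[N]subn0 -/(index_iota 0 N) big_mkord; apply: eq_bigr => k _.
rewrite intZ; last exact: itgD.
rewrite intD// intZ; last exact: itgD.
by rewrite intD.
Qed.

(** In the limit only the moment [r 0] survives. Inside the sum it occurs just for [k = 0], with
    coefficient [t]; taking [N.+1] terms ensures that this one is present. *)
Let approx_cvg t N : (fun n => intI (fun x => approx t N.+1 n x * rho x)) @ \oo --> t - ln 2.
Proof.
rewrite (_ : (fun _ => _) = fun n => \sum_(k < N.+1) (- 2 * (- t) ^+ k.+1 / k.+1%:R) * (r k.+1 n + 2^-1 * (r k.+2 n + r k n)) - ln 2 * (1 + r 1%N n)); last first.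
  by apply/funext => n; case: (approx_itg t N.+1 n).
have -> : t - ln 2 = \sum_(k < N.+1) (- 2 * (- t) ^+ k.+1 / k.+1%:R) * ((k.+1 == 0%N)%:R + 2^-1 * ((k.+2 == 0%N)%:R + (k == 0%N :> nat)%:R)) - ln 2 * (1 + (1%N == 0%N)%:R).
  rewrite big_ord_recl big1 /=; last by move=> k _; rewrite ?mulr0n ?mulr0 ?addr0 ?mulr0 ?addr0 ?mulr0.
  by rewrite expr1; field.
apply: cvgB.
  apply: (@cvg_sum_nat N.+1 (fun k n : nat => (- 2 * (- t) ^+ k.+1 / k.+1%:R) * (r k.+1 n + 2^-1 * (r k.+2 n + r k n)))
   (fun k : nat => (- 2 * (- t) ^+ k.+1 / k.+1%:R) * ((k.+1 == 0%N)%:R + 2^-1 * ((k.+2 == 0%N)%:R + (k == 0%N)%:R)))) => k.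
  apply: cvgMr; apply: cvgD; first exact: r_cvg.
  by apply: cvgMr; apply: cvgD; exact: r_cvg.
by apply: cvgMr; apply: cvgD; [exact: cvg_cst|exact: r_cvg].
Qed.

Lemma osc_bounds n x : I x -> 0 <= 1 + Re (osc n x) <= 2.
Proof.
move=> Ix; have := @normr_Re_le1 R (osc n x); rewrite nsq_osc// => /(_ (lexx _)).
by rewrite ler_norml => /andP[? ?]; apply/andP; split; lra.
Qed.

Lemma itg_xlnx_osc n : itg (fun x => (1 + Re (osc n x)) * ln (1 + Re (osc n x)) * rho x).
Proof.
apply: itgM_rho; split.
  have m1 : measurable_fun I (fun x => 1 + Re (osc n x)).
    by apply: measurable_funD => //; apply: bmf_meas; case: (bmc_osc n).
  by apply: measurable_funM => //; apply: measurableT_comp => //; exact: measurable_ln.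
exists 4 => x Ix; have /andP[a0 a2] := osc_bounds n Ix.
set a := 1 + _ in a0 a2 *.
move: a0; rewrite le_eqVlt => /predU1P[<-|a0]; first by rewrite mul0r normr0.
have h1 := exp_tangent (ltr01 : 0 < (1 : R)) a0; rewrite ln1 in h1.
have h2 := exp_tangent a0 (ltr01 : 0 < (1 : R)); rewrite ln1 in h2.
have h3 : a * ln a <= a * 1 by rewrite ler_pM2l//; lra.
by rewrite ler_norml; apply/andP; split; lra.
Qed.

Lemma xlnx_osc_cvg :
  (fun n => intI (fun x => (1 + Re (osc n x)) * ln (1 + Re (osc n x)) * rho x)) @ \oo --> (1 - ln 2 : R).
Proof.
apply/cvgrPdist_le => e e0.
(* Error budget: [4 h <= e / 6] for the regularization, [e / 4] for the tail of the series, [e / 4]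
   for the limit in [n], and [h <= e / 24] for replacing [t] by 1. *)
pose h := Order.min 2^-1 (e / 24).
have h0 : 0 < h by rewrite lt_min invr_gt0 ltr0n divr_gt0.
have h1 : h <= 2^-1 by rewrite ge_min lexx.
have h2 : h <= e / 24 by rewrite ge_min lexx orbT.
pose t := 1 - h.
have t1 : 2^-1 <= t < 1 by rewrite /t; apply/andP; split; lra.
have t01 : 0 <= t < 1 by rewrite /t; apply/andP; split; lra.
have [N HN] : exists N, 4 * (t ^+ N.+2 / (1 - t)) <= e / 4.
  have c1 : (fun N => t ^+ N) @ \oo --> (0 : R) by apply: cvg_expr; rewrite ger0_norm; case/andP: t01.
  have e1 : 0 < e / 16 * h by rewrite mulr_gt0// divr_gt0.
  move/cvgrPdist_le: c1 => /(_ _ e1)[N _ H]; exists N.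
  have /H /= : (N <= N.+2)%N by lia.
  rewrite sub0r normrN ger0_norm ?exprn_ge0//; last by case/andP: t01.
  have -> : 1 - t = h by rewrite /t; ring.
  by move=> H2; have : t ^+ N.+2 / h <= e / 16; [rewrite ler_pdivrMr|lra].
have e2 : 0 < e / 4 by rewrite divr_gt0.
have [N0 _ HN0] : \forall n \near \oo, `|t - ln 2 - intI (fun x => approx t N.+1 n x * rho x)| <= e / 4.
  by have /cvgrPdist_le /(_ _ e2) := @approx_cvg t N.
exists N0 => //.
move=> n /HN0 /= Hn.
have iX := itg_xlnx_osc n.
have [iA _] := approx_itg t N.+1 n.
have D : `|intI (fun x => (1 + Re (osc n x)) * ln (1 + Re (osc n x)) * rho x) - intI (fun x => approx t N.+1 n x * rho x)| <= e / 6 + e / 4.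
  rewrite -intB//; apply: le_trans (int_abs _) _; first exact: itgB.
  rewrite -[leRHS]mulr1 -[X in _ <= _ * X](int_rho R) -intZ; last exact: itg_rho.
  apply: le_int; [by apply: itg_abs; exact: itgB|by apply: itgZ; exact: itg_rho|].
  move=> x Ix; rewrite -mulrBl normrM (ger0_norm (rho_ge0 x)) ler_wpM2r ?rho_ge0//.
  have a02 := osc_bounds n Ix; have /andP[a0 a2] := a02.
  have := xlnx_approx a02 t1.
  have tn : nsq (real_complex R (- t) * osc n x) <= t ^+ 2.
    by rewrite nsqM nsq_osc// mulr1 /nsq /= expr0n addr0 sqrrN.
  have := log_series N.+1 tn t01.
  have -> : nsq (1 - real_complex R (- t) * osc n x) = (1 - t) ^+ 2 + 2 * t * (1 + Re (osc n x)).
    by rewrite nsq_1B nsq_osc//; ring.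
  rewrite /approx; set S := \sum_(k < N.+1) _; set L := ln (_ + _); set a := 1 + Re _ in a0 a2 *.
  move: HN; set E := t ^+ N.+2 / (1 - t) => HN l1 l2.
  have l3 : `|a * (L + 2 * S)| <= 2 * (2 * E).
    by rewrite normrM ler_pM// ger0_norm.
  have -> : a * ln a - a * (- 2 * S - ln 2) = (a * ln a - a * (L - ln 2)) + a * (L + 2 * S) by ring.
  apply: le_trans (ler_normD _ _) _; apply: lerD.
    by apply: le_trans l2 _; rewrite /t; lra.
  by apply: le_trans l3 _; lra.
move: D Hn; rewrite !ler_norml => /andP[D1 D2] /andP[D3 D4].
by apply/andP; split; move: D1 D2 D3 D4 h2; rewrite /t; lra.
Qed.

End oscillation.

(** * The truncated entropy *)

Section truncated_entropy.
Variable R : realType.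
Local Notation mu := (@lebesgue_measure R).
Local Notation I := (@I11 R).
Local Notation C := (R[i]%type).

(** The increment is split as [(u - v) ((u + v) ln u) + v^2 (ln u - ln v)]. Since [u ln u] is
    bounded and [v (ln u - ln v) <= u - v], nothing has to be differentiated near 0. *)
Lemma sqr_ln_lip (M u v : R) : 0 <= v <= u -> u <= M ->
  `|u ^+ 2 * ln u - v ^+ 2 * ln v| <= (2 * (1 + M ^+ 2) + M) * (u - v).
Proof.
move=> /andP[v0 vu] uM; have u0 := le_trans v0 vu.
have M0 := le_trans u0 uM.
have uv0 : 0 <= u - v by rewrite subr_ge0.
have M2 := sqr_ge0 M; have uM2 : u ^+ 2 <= M ^+ 2 by rewrite lerXn2r ?nnegrE.
move: u0; rewrite le_eqVlt => /predU1P[u0|u0].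
  have v00 : v = 0 by apply/eqP; rewrite eq_le v0 andbT u0.
  by rewrite -u0 v00 subrr normr0 subrr mulr0.
have ulnu : `|u * ln u| <= 1 + M ^+ 2.
  have h1 := exp_tangent (ltr01 : 0 < (1 : R)) u0; rewrite ln1 in h1.
  have h2 := exp_tangent u0 (ltr01 : 0 < (1 : R)); rewrite ln1 in h2.
  have h3 : u * (ln u) <= u * u by rewrite ler_pM2l//; lra.
  rewrite -expr2 in h3.
  by rewrite ler_norml; apply/andP; split; lra.
move: v0; rewrite le_eqVlt => /predU1P[<-|v0].
  rewrite expr0n mul0r !subr0 expr2 -mulrA normrM (gtr0_norm u0) mulrC ler_wpM2r ?(ltW u0)//.
  by apply: le_trans ulnu _; lra.
have lv : 0 <= v ^+ 2 * (ln u - ln v) <= M * (u - v).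
  have luv : ln v <= ln u by rewrite ler_ln.
  rewrite mulr_ge0 ?sqr_ge0 ?subr_ge0//=.
  have := exp_tangent v0 u0 => h.
  have h2 : v * (v * (ln u - ln v)) <= v * (u - v) by rewrite ler_pM2l//; lra.
  apply: le_trans (_ : v * (u - v) <= _); first by rewrite expr2 -mulrA.
  by rewrite ler_wpM2r// (le_trans vu).
have -> : u ^+ 2 * ln u - v ^+ 2 * ln v = (u - v) * ((u + v) * ln u) + v ^+ 2 * (ln u - ln v) by ring.
apply: le_trans (ler_normD _ _) _; rewrite [leRHS]mulrDl; apply: lerD; last first.
  by case/andP: lv => lv0 lv1; rewrite ger0_norm.
rewrite normrM (ger0_norm uv0) mulrC ler_wpM2r//.
apply: le_trans (_ : 2 * `|u * ln u| <= _); last by rewrite ler_pM2l.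
rewrite !normrM (gtr0_norm u0) mulrA ler_wpM2r//.
have uv : 0 <= u + v by lra.
by rewrite ger0_norm//; lra.
Qed.

Lemma sqr_ln_lip_norm (M f g : R) : `|f| <= M -> `|g| <= M ->
  `|ln (f ^+ 2) * f ^+ 2 - ln (g ^+ 2) * g ^+ 2| <= 2 * (2 * (1 + M ^+ 2) + M) * `|f - g|.
Proof.
have E (a : R) : ln (a ^+ 2) * a ^+ 2 = 2 * (`|a| ^+ 2 * ln `|a|).
  rewrite -(real_normK (num_real a)); have := normr_ge0 a.
  rewrite le_eqVlt => /predU1P[<-|a0]; first by rewrite expr0n !(mulr0, mul0r).
  rewrite lnXn// -[ln _ *+ 2]mulr_natl; ring.
wlog gf : f g / `|g| <= `|f|.
  move=> H fM gM; have [gf|/ltW gf] := lerP `|g| `|f|; first exact: H.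
  by rewrite distrC (distrC f); exact: H.
move=> fM gM; rewrite !E -mulrBr normrM ger0_norm// -mulrA ler_pM2l//.
have M0 : 0 <= M by exact: le_trans fM.
apply: le_trans (sqr_ln_lip (_ : 0 <= `|g| <= `|f|) fM) _; first by rewrite normr_ge0.
apply: ler_wpM2l; first by rewrite addr_ge0// mulr_ge0// addr_ge0// sqr_ge0.
exact: le_trans (ler_norm _) (ler_dist_dist _ _).
Qed.

Definition trunc_xlnx (M f : R) : R := if M <= `|f| then 0 else ln (f ^+ 2) * f ^+ 2.

(** The truncation jumps only where [|f| >= M], hence at distance at least [M - sqrt 2] from [g];
    the size of [g^2 ln g^2] divided by this gap is absorbed in [L]. *)
Lemma trunc_lip (M : R) : Num.sqrt 2 < M -> exists L : R, 0 <= L /\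
  forall f g, `|g| <= Num.sqrt 2 -> `|trunc_xlnx M f - ln (g ^+ 2) * g ^+ 2| <= L * `|f - g|.
Proof.
move=> M2; have s0 : 0 <= Num.sqrt 2 :> R by exact: sqrtr_ge0.
have M0 : 0 < M by exact: le_lt_trans M2.
pose L1 := 2 * (2 * (1 + M ^+ 2) + M).
have L10 : 0 <= L1 by rewrite mulr_ge0// addr_ge0 ?(ltW M0)// mulr_ge0// addr_ge0// sqr_ge0.
have D0 : 0 < M - Num.sqrt 2 by rewrite subr_gt0.
have L20 : 0 <= L1 * Num.sqrt 2 / (M - Num.sqrt 2) by rewrite divr_ge0 ?(ltW D0)// mulr_ge0.
exists (L1 + L1 * Num.sqrt 2 / (M - Num.sqrt 2)); split; first exact: addr_ge0.
move=> f g g2; have gM : `|g| <= M by exact: le_trans g2 (ltW M2).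
rewrite /trunc_xlnx; case: ifPn => [Mf|]; last first.
  rewrite -ltNge => fM; apply: le_trans (sqr_ln_lip_norm (ltW fM) gM) _.
  by rewrite ler_wpM2r// lerDl.
have G0 := sqr_ln_lip_norm (_ : `|0| <= M) gM; rewrite normr0 in G0.
have {}G0 := G0 (ltW M0); rewrite expr0n mulr0 sub0r normrN sub0r normrN -/L1 in G0.
rewrite sub0r normrN; apply: le_trans G0 _.
apply: le_trans (_ : L1 * Num.sqrt 2 <= _); first by rewrite ler_wpM2l.
have fg : M - Num.sqrt 2 <= `|f - g|.
  have := lerB_dist f g; lra.
apply: le_trans (_ : L1 * Num.sqrt 2 / (M - Num.sqrt 2) * `|f - g| <= _); last first.
  by rewrite ler_wpM2r// lerDr.
by rewrite [leRHS]mulrAC ler_pdivlMr// ler_wpM2l// mulr_ge0.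
Qed.

(* [1 - D e^2], with [D = |F|^2] and [e = exp (- ln D / 2)], is the indicator of
   [F = 0] because [ln 0 = 0]; it keeps [s] unimodular at the zeros of [F]. *)
Lemma unimodular_phase (F : R -> C) : bmc F -> exists s : R -> C,
  [/\ bmc s, forall x, I x -> nsq (s x) = 1 & forall x, F x = real_complex R (Num.sqrt (nsq (F x))) * s x].
Proof.
move=> bF; have [[m1 _] [m2 _]] := bF.
have mD := bmf_meas (bmf_nsq bF).
pose e x := expR (- 2^-1 * ln (nsq (F x))).
pose s x : C := real_complex R (e x) * F x + real_complex R (1 - nsq (F x) * e x ^+ 2).
have e2 x : 0 < nsq (F x) -> nsq (F x) * e x ^+ 2 = 1.
  move=> D0; rewrite /e -expRM_natl; have -> : 2%:R * (- 2^-1 * ln (nsq (F x))) = - ln (nsq (F x)) by field.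
  by rewrite expRN lnK// mulfV// gt_eqF.
have cases x : nsq (F x) = 0 \/ 0 < nsq (F x).
  by have := nsq_ge0 (F x); rewrite le_eqVlt => /predU1P[<-|]; [left|right].
have s_1 x : nsq (s x) = 1.
  rewrite /s; have [D0|D0] := cases x.
    rewrite D0 mul0r subr0; have /eqP : nsq (F x) == 0 by rewrite D0.
    by move/eqP; rewrite nsq_eq0 => /eqP ->; rewrite mulr0 add0r nsq1.
  rewrite e2// subrr addr0 nsqM -(e2 _ D0) mulrC; congr (_ * _).
  by rewrite /nsq /= expr0n addr0.
have me : measurable_fun I e.
  apply: measurableT_comp => //; apply: measurable_funM => //.
  by apply: measurableT_comp => //; exact: measurable_ln.
have mc : measurable_fun I (fun x => 1 - nsq (F x) * e x ^+ 2).
  by apply: measurable_funB => //; apply: measurable_funM => //; exact: measurable_funX.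
exists s; split => //.
- split; apply: bmf_le1.
  + rewrite (_ : (fun _ => _) = fun x => e x * Re (F x) + (1 - nsq (F x) * e x ^+ 2)).
      by apply: measurable_funD => //; exact: measurable_funM.
    by apply/funext => x; rewrite ReD Re_realM.
  + by move=> x _; apply: normr_Re_le1; rewrite s_1.
  + rewrite (_ : (fun _ => _) = fun x => e x * Im (F x)); first exact: measurable_funM.
    by apply/funext => x; rewrite ImD ImM Re_real Im_real mul0r !addr0.
  + by move=> x _; apply: normr_Im_le1; rewrite s_1.
- move=> x; rewrite /s; have [D0|D0] := cases x.
    rewrite D0 sqrtr0; have /eqP : nsq (F x) == 0 by rewrite D0.
    by move/eqP; rewrite nsq_eq0 => /eqP ->; rewrite rmorph0 mul0r.
  rewrite e2// subrr addr0 mulrA -rmorphM.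
  have -> : Num.sqrt (nsq (F x)) * e x = 1.
    apply/eqP; rewrite -(@eqrXn2 _ 2) ?mulr_ge0 ?sqrtr_ge0 ?expR_ge0//.
    by rewrite expr1n exprMn sqr_sqrtr ?nsq_ge0// e2.
  by rewrite rmorph1 mul1r.
Qed.

Lemma integral_split (F : R -> R) (D : set R) : measurable_fun I F -> measurable D -> D `<=` I ->
  (forall x, D x -> 0 <= F x) -> itg (F \_ (~` D)) ->
  (\int[mu]_(x in I) (F x)%:E = (intI (F \_ (~` D)))%:E + \int[mu]_(x in D) (F x)%:E)%E.
Proof.
move=> mF mD DI F0 ih.
pose h := F \_ (~` D); pose k := F \_ D.
have mk : measurable_fun I k.
  apply: (proj1 (measurable_restrict F mD (@mI R))).
  exact: (measurable_funS (@mI R) (@subIsetl _ I D) mF).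
have mh : measurable_fun I h by exact: itg_meas.
have k0 x : 0 <= k x by rewrite /k patchE; case: ifPn => // /set_mem; exact: F0.
have kE : (\int[mu]_(x in D) (F x)%:E = \int[mu]_(x in I) (k x)%:E)%E.
  rewrite -{1}(setIidr DI) integral_mkcondr; apply: eq_integral => x _.
  by rewrite /k !patchE; case: ifP.
have pE x : ((EFin \o F)^\+ x = (EFin \o h)^\+ x + (k x)%:E)%E.
  rewrite !funeposE /= /h /k !patchE in_setC.
  have [/set_mem Dx|Dx] /= := boolP (x \in D).
    by rewrite maxxx add0e; apply/max_idPl; rewrite lee_fin; exact: F0.
  by rewrite adde0.
have nE x : ((EFin \o F)^\- x = (EFin \o h)^\- x)%E.
  rewrite !funenegE /= /h !patchE in_setC.
  have [/set_mem Dx|Dx] //= := boolP (x \in D).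
  by rewrite oppr0 maxxx; apply/max_idPr; rewrite lee_fin oppr_le0; exact: F0.
have E1 : (\int[mu]_(x in I) (EFin \o F)^\+ x = \int[mu]_(x in I) ((EFin \o h)^\+ x + (k x)%:E))%E.
  by apply: eq_integral => x _; exact: pE.
have E2 : (\int[mu]_(x in I) (EFin \o F)^\- x = \int[mu]_(x in I) (EFin \o h)^\- x)%E.
  by apply: eq_integral => x _; exact: nE.
rewrite (_ : (fun x => (F x)%:E) = EFin \o F)// integralE E1 E2.
rewrite ge0_integralD//; last 3 first.
- by apply: measurable_funepos; exact/measurable_EFinP.
- by move=> x _; rewrite lee_fin.
- exact/measurable_EFinP.
rewrite kE -int_EFin// [X in _ = (X + _)%E]integralE -/h.
by rewrite addeAC.
Qed.

End truncated_entropy.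

(** * Convergence of the truncated entropy and conclusion *)

Section entropy_asymptotics.
Variable R : realType.
Local Notation mu := (@lebesgue_measure R).
Local Notation I := (@I11 R).
Local Notation C := (R[i]%type).
Variables (w : R -> R) (p : nat -> {poly R}).
Hypothesis w_ge0 : forall x, I x -> 0 <= w x.
Hypothesis w_itg : itg w.
Hypothesis w0_pos : {ae mu, forall x, I x -> 0 < w0 w x}.
Hypothesis logw0 : itg (fun x => ln (w0 w x) * rho x).
Hypothesis p_on : orthonormal_polys w p.

Lemma szego_infimum : exists m : R, [/\ 0 < m,
  forall A : {poly R}, A.[0] = 1 -> m <= nrm w A &
  forall e : R, 0 < e -> exists A : {poly R}, A.[0] = 1 /\ nrm w A <= m + e].
Proof.
pose E : set R := [set r | exists A : {poly R}, A.[0] = 1 /\ nrm w A = r].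
have lbE : lbound E (geom_mean w).
  by move=> _ [A [A1 <-]]; exact: jensen_lower.
have hE : has_inf E.
  split; last by exists (geom_mean w).
  by exists (nrm w 1); exists 1; rewrite hornerC.
exists (inf E); split.
- apply: lt_le_trans (expR_gt0 _) _; apply: lb_le_inf lbE; by case: hE.
- by move=> A A1; apply: ge_inf; [case: hE|exists A].
- move=> e e0; have [_ [A [A1 <-]] /ltW h] := inf_adherent e0 hE.
  by exists A.
Qed.

Lemma w0_ge0 x : I x -> 0 <= w0 w x.
Proof. by move=> Ix; rewrite /w0 mulr_ge0 ?w_ge0// mulr_ge0 ?pi_ge0 ?sqrtr_ge0. Qed.

Lemma measurable_fn n : measurable_fun I (fn w p n).
Proof.
apply: measurable_funM; first by apply: bmf_meas; exact: bmf_poly.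
apply: (measurableT_comp (continuous_measurable_fun (@sqrt_continuous R))).
apply: measurable_funM; last exact: itg_meas.
apply: measurable_funM; first exact: measurable_cst.
by apply: measurable_funTS; apply: continuous_measurable_fun; exact: continuous_ysqrt.
Qed.

Lemma fn_sqr n x : I x -> fn w p n x ^+ 2 = (p n).[x] ^+ 2 * w0 w x.
Proof. by move=> Ix; rewrite exprMn sqr_sqrtr// w0_ge0. Qed.

Definition trunc_dens (M : R) (n : nat) (x : R) : R := trunc_xlnx M (fn w p n x) * rho x.

Lemma measurable_Delta M n : measurable (Delta w p n M).
Proof.
have -> : Delta w p n M = I `&` (fun x => `|fn w p n x|) @^-1` `[M, +oo[%classic.
  by apply/seteqP; split => x [Ix /= h]; split => //; move: h; rewrite in_itv /= andbT.
have mn : measurable_fun I (fun x => `|fn w p n x|).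
  by apply: measurableT_comp => //; exact: measurable_fn.
by apply: mn => //; exact: measurable_itv.
Qed.

Lemma trunc_dens_restrict M n x : I x ->
  trunc_dens M n x = ((fun x => ln (fn w p n x ^+ 2) * fn w p n x ^+ 2 * rho x) \_ (~` Delta w p n M)) x.
Proof.
move=> Ix; rewrite /trunc_dens /trunc_xlnx patchE in_setC.
have -> : (x \in Delta w p n M) = (M <= `|fn w p n x|).
  by apply/idP/idP => [/set_mem[]//|h]; apply/mem_set.
by case: ifP; rewrite ?mul0r.
Qed.

Lemma measurable_dens n : measurable_fun I (fun x => ln (fn w p n x ^+ 2) * fn w p n x ^+ 2 * rho x).
Proof.
have m2 : measurable_fun I (fun x => fn w p n x ^+ 2) by apply: measurable_funX; exact: measurable_fn.
apply: measurable_funM; last exact: measurable_rho.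
by apply: measurable_funM => //; apply: measurableT_comp => //; exact: measurable_ln.
Qed.

Lemma measurable_trunc_dens M n : measurable_fun I (trunc_dens M n).
Proof.
apply: (@eq_measurable_fun _ _ _ _ _ ((fun x => ln (fn w p n x ^+ 2) * fn w p n x ^+ 2 * rho x) \_ (~` Delta w p n M))).
  by move=> x /set_mem Ix; rewrite trunc_dens_restrict.
have mD : measurable (~` Delta w p n M) by apply: measurableC; exact: measurable_Delta.
apply: (proj1 (measurable_restrict _ mD (@mI R))).
exact: (measurable_funS (@mI R) (@subIsetl _ _ _) (measurable_dens n)).
Qed.

Lemma itg_trunc_dens M n : 0 <= M -> itg (trunc_dens M n).
Proof.
move=> M0; pose K := 2 * (2 * (1 + M ^+ 2) + M) * M.
apply: (itg_le (measurable_trunc_dens M n) _ (itgZ K (@itg_rho R))) => x Ix.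
rewrite normrM (ger0_norm (rho_ge0 x)) ler_wpM2r ?rho_ge0// /trunc_xlnx.
have K0 : 0 <= 2 * (2 * (1 + M ^+ 2) + M).
  by rewrite mulr_ge0// addr_ge0// mulr_ge0// addr_ge0// sqr_ge0.
case: ifPn => [_|]; first by rewrite normr0 mulr_ge0.
rewrite -ltNge => /ltW fM; have := @sqr_ln_lip_norm R M (fn w p n x) 0 fM.
rewrite normr0 => /(_ M0); rewrite expr0n mulr0 !subr0 => /le_trans; apply.
by rewrite /K ler_wpM2l.
Qed.

(** With [a = sqrt (|A|^2 w0 / m)] the difference is [sqrt 2 q (a - 1)] with [|q| <= 1]. The
    inequality [(a - 1)^2 <= |a^2 - 1|] for [a >= 0] turns [L^1] closeness of the densities into
    [L^2] closeness of the profiles. *)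
Lemma osc_profile_close (s : R -> C) (A : {poly R}) (m : R) n x : 0 < m -> I x ->
  ev A x = real_complex R (Num.sqrt (nsq (ev A x))) * s x -> nsq (s x) = 1 ->
  (Num.sqrt (2 / m) * Re (zc x ^+ n * conjc (ev A x)) * Num.sqrt (w0 w x)
    - Num.sqrt 2 * Re (zc x ^+ n * conjc (s x))) ^+ 2 * rho x <=
  2 / m * `|nsq (ev A x) * w x - m * rho x|.
Proof.
move=> m0 Ix As s1; have rhs0 : 0 <= 2 / m * `|nsq (ev A x) * w x - m * rho x|.
  by rewrite mulr_ge0// divr_ge0// ltW.
have [x1|x1] := pselect (-1 < x < 1); last by rewrite [X in _ * X <= _](rho_endpoint Ix x1) mulr0.
set q := Re (zc x ^+ n * conjc (s x)).
have q1 : q ^+ 2 <= 1.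
  by apply: le_trans (sqr_Re_le _) _; rewrite nsqM nsqX nsq_zc// expr1n nsqJ s1 mulr1.
have -> : Re (zc x ^+ n * conjc (ev A x)) = Num.sqrt (nsq (ev A x)) * q.
  by rewrite {1}As conjcM conjc_real mulrCA Re_realM.
have c2 : Num.sqrt (2 / m) = Num.sqrt 2 * Num.sqrt m^-1 by rewrite sqrtrM.
pose a := Num.sqrt m^-1 * Num.sqrt (nsq (ev A x)) * Num.sqrt (w0 w x).
have a0 : 0 <= a by rewrite !mulr_ge0 ?sqrtr_ge0.
have a2 : a ^+ 2 = m^-1 * nsq (ev A x) * w0 w x.
  by rewrite !exprMn !sqr_sqrtr ?nsq_ge0 ?w0_ge0// invr_ge0 ltW.
have -> : Num.sqrt (2 / m) * (Num.sqrt (nsq (ev A x)) * q) * Num.sqrt (w0 w x) - Num.sqrt 2 * q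
  = Num.sqrt 2 * q * (a - 1) by rewrite c2 /a; ring.
have -> : 2 / m * `|nsq (ev A x) * w x - m * rho x| = 2 * `|a ^+ 2 - 1| * rho x.
  rewrite a2 -{1}(w0_rho w x1).
  have -> : nsq (ev A x) * (w0 w x * rho x) - m * rho x = m * ((m^-1 * nsq (ev A x) * w0 w x - 1) * rho x).
    by field; rewrite gt_eqF.
  rewrite normrM (gtr0_norm m0) normrM (ger0_norm (rho_ge0 x)) !mulrA.
  by rewrite -[2 / m * m]mulrA mulVf ?gt_eqF// mulr1.
clearbody a; rewrite ler_wpM2r ?rho_ge0// !exprMn sqr_sqrtr// -mulrA ler_pM2l//.
apply: le_trans (_ : (a - 1) ^+ 2 <= _); first by rewrite ler_piMl ?sqr_ge0.
have -> : a ^+ 2 - 1 = (a - 1) * (a + 1) by ring.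
rewrite normrM -real_normK ?num_real// expr2 ler_wpM2l//.
by rewrite [leRHS]ger0_norm ?addr_ge0// ler_norml; apply/andP; split; lra.
Qed.

(** Stands in for Cauchy-Schwarz: an [L^1(rho)] bound from an [L^2(rho)] bound at the cost of [k],
    as [rho] has mass 1. *)
Lemma young_le (k a r : R) : 0 < k -> 0 <= r -> `|a| * r <= k * r + (4 * k)^-1 * (a ^+ 2 * r).
Proof.
move=> k0 r0; rewrite mulrA -mulrDl ler_wpM2r//.
rewrite -real_normK ?num_real//; set b := `|a|.
rewrite -subr_ge0.
have -> : k + (4 * k)^-1 * b ^+ 2 - b = (4 * k)^-1 * (2 * k - b) ^+ 2 by field; rewrite gt_eqF.
by rewrite mulr_ge0 ?sqr_ge0// invr_ge0 mulr_ge0// ltW.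
Qed.

Lemma trunc_entropy_cvg (M : R) : Num.sqrt 2 < M ->
  (fun n => intI (trunc_dens M n)) @ \oo --> (1 - ln 2 : R).
Proof.
move=> M2; have M0 : 0 <= M by apply: le_trans (ltW M2); exact: sqrtr_ge0.
have [m [m0 m_lb m_inf]] := szego_infimum.
have [L [L0 HL]] := trunc_lip M2.
pose K := szego_cst m + 2 / m * (2 * m + 4).
have K0 : 0 <= K.
  rewrite /K /szego_cst; have m1 : 0 <= 2 / m by rewrite divr_ge0// ltW.
  have a1 : 0 <= (5 + 2 / m) / 2 * Num.sqrt (2 / m) by rewrite mulr_ge0 ?sqrtr_ge0//; lra.
  have a2 : 0 <= 2 / m * (2^-1 + (2 + m) / 4) by rewrite mulr_ge0//; lra.
  have a3 : 0 <= 2 / m * (2 * m + 4) by rewrite mulr_ge0//; lra.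
  lra.
apply/cvgrPdist_le => e e0.
(* First [k] makes the constant part [2 k L] at most [e / 4]; then [d] makes the part
   [L d K / (4 k)] at most [e / 4]. The [+ 1] only guards against division by 0. *)
pose k := e / (8 * (L + 1)).
have L1 : 0 < L + 1 by rewrite ltr_wpDl.
have K1 : 0 < K + 1 by rewrite ltr_wpDl.
have k0 : 0 < k by rewrite divr_gt0// mulr_gt0.
pose d := Order.min 1 (k * e / ((L + 1) * (K + 1))).
have d0 : 0 < d by rewrite lt_min ltr01 divr_gt0// mulr_gt0.
have d1 : d <= 1 by rewrite ge_min lexx.
have dle : d * ((L + 1) * (K + 1)) <= k * e by rewrite -ler_pdivlMr ?mulr_gt0// ge_min lexx orbT.
(* [A] and its phase [s] are fixed before [n]; afterwards only [n >= size A] is required. *)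
have [A [A1 Am]] := m_inf _ (exprn_gt0 2 d0).
have [s [bs s1 As]] := unimodular_phase (bmc_ev A).
have D2 := near_min_L1_arcsine w_ge0 w_itg m0 m_lb m_inf d0 d1 A1 Am.
have e2 : 0 < e / 2 by rewrite divr_gt0.
have [N _ HN] : \forall n \near \oo, `|1 - ln 2 - intI (fun x => (1 + Re (osc s n x)) * ln (1 + Re (osc s n x)) * rho x)| <= e / 2.
  by have /cvgrPdist_le /(_ _ e2) := xlnx_osc_cvg bs s1.
exists (maxn N (size A)) => // n; rewrite /= geq_max => /andP[/HN /= Hn An].
have D1 := szego_asymptotics w_ge0 w_itg p_on m0 m_lb d0 d1 A1 Am An.
have iT := itg_trunc_dens n M0.
have iX := itg_xlnx_osc bs s1 n.
set c := Num.sqrt (2 / m) in D1.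
pose E1 x := ((p n).[x] - c * Re (zc x ^+ n * conjc (ev A x))) ^+ 2 * w x.
pose E2 x := `|nsq (ev A x) * w x - m * rho x|.
have iE1 : itg E1.
  apply: itgM => //; apply: bmfX; apply: bmfB; first exact: bmf_poly.
  apply: bmfM; first exact: bmf_cst.
  by case: (bmcM (bmcX n (@bmc_zc R)) (bmcJ (bmc_ev A))).
have iE2 : itg E2.
  by apply: itg_abs; apply: itgB; [exact: itg_nrm|apply: itgZ; exact: itg_rho].
have iR := @itg_rho R.
have iB : itg (fun x => 2 * k * rho x + (4 * k)^-1 * (E1 x + 2 / m * E2 x)).
  by apply: itgD; apply: itgZ => //; apply: itgD => //; exact: itgZ.
have main : `|intI (trunc_dens M n) - intI (fun x => (1 + Re (osc s n x)) * ln (1 + Re (osc s n x)) * rho x)| <=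
   L * intI (fun x => 2 * k * rho x + (4 * k)^-1 * (E1 x + 2 / m * E2 x)).
  rewrite -intB// -intZ//; apply: le_trans (int_abs _) _; first exact: itgB.
  apply: le_int; [by apply: itg_abs; exact: itgB|exact: itgZ|move=> x Ix].
  pose g := Num.sqrt 2 * Re (zc x ^+ n * conjc (s x)).
  set f := fn w p n x.
  set v := zc x ^+ n * conjc (s x) in g.
  have v1 : nsq v = 1 by rewrite nsqM nsqX nsq_zc// expr1n nsqJ s1// mulr1.
  have g2 : g ^+ 2 = 1 + Re (osc s n x).
    rewrite /g exprMn sqr_sqrtr// /osc -/v [v ^+ 2]expr2 [X in _ = _ + X]ReM.
    by have := v1; rewrite /nsq; lra.
  have gle : `|g| <= Num.sqrt 2.
    rewrite normrM (ger0_norm (sqrtr_ge0 _)) ler_piMr ?sqrtr_ge0//.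
    by apply: normr_Re_le1; rewrite v1.
  have h1 := HL f g gle; rewrite g2 (mulrC (ln _)) in h1.
  rewrite /trunc_dens -mulrBl normrM (ger0_norm (rho_ge0 x)).
  apply: le_trans (ler_wpM2r (rho_ge0 x) h1) _; rewrite -[leLHS]mulrA. rewrite ler_wpM2l//.
  (* [al] compares [p_n] with the profile of [A] and is controlled by [szego_asymptotics]; [be]
     replaces the modulus of [A] by its ideal value and is controlled by [osc_profile_close]. *)
  pose al := ((p n).[x] - c * Re (zc x ^+ n * conjc (ev A x))) * Num.sqrt (w0 w x).
  pose be := c * Re (zc x ^+ n * conjc (ev A x)) * Num.sqrt (w0 w x) - g.
  have -> : f - g = al + be by rewrite /f /fn /al /be; ring.
  apply: le_trans (ler_wpM2r (rho_ge0 x) (ler_normD _ _)) _; rewrite mulrDl.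
  have ha := young_le al k0 (rho_ge0 x); have hb := young_le be k0 (rho_ge0 x).
  have ha2 : al ^+ 2 * rho x <= E1 x.
    rewrite /al /E1 exprMn sqr_sqrtr ?w0_ge0// -mulrA ler_wpM2l ?sqr_ge0//.
    have [x1|x1] := pselect (-1 < x < 1); first by rewrite (w0_rho w x1).
    by rewrite (rho_endpoint Ix x1) mulr0 w_ge0.
  have hb2 : be ^+ 2 * rho x <= 2 / m * E2 x by exact: (osc_profile_close n m0 Ix (As x) (s1 x Ix)).
  have k4 : 0 <= (4 * k)^-1 by rewrite invr_ge0 mulr_ge0// ltW.
  have := ler_wpM2l k4 ha2; have := ler_wpM2l k4 hb2; lra.
have small : L * intI (fun x => 2 * k * rho x + (4 * k)^-1 * (E1 x + 2 / m * E2 x)) <= e / 2.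
  rewrite intD; [|exact: itgZ|by apply: itgZ; apply: itgD => //; exact: itgZ].
  rewrite !intZ//; last by apply: itgD => //; exact: itgZ.
  rewrite intD//; last exact: itgZ.
  rewrite intZ// int_rho mulr1.
  have h1 : intI E1 + 2 / m * intI E2 <= d * K.
    rewrite /K mulrDr; apply: lerD => //; rewrite mulrCA; apply: ler_wpM2l => //.
    by rewrite divr_ge0// ltW.
  have h2 : L * (2 * k) <= e / 4.
    have -> : e / 4 = (L + 1) * (2 * k) by rewrite /k; field; rewrite gt_eqF.
    by apply: ler_wpM2r; [rewrite mulr_ge0// ltW|lra].
  have h3 : L * ((4 * k)^-1 * (d * K)) <= e / 4.
    have -> : e / 4 = (4 * k)^-1 * (k * e) by field; rewrite gt_eqF.
    have k40 : 0 < (4 * k)^-1 by rewrite invr_gt0 mulr_gt0.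
    rewrite mulrCA ler_pM2l//; apply: (le_trans _ dle).
    by rewrite mulrCA ler_pM2l//; apply: ler_pM => //; lra.
  have h4 : L * ((4 * k)^-1 * (intI E1 + 2 / m * intI E2)) <= L * ((4 * k)^-1 * (d * K)).
    by rewrite ler_wpM2l// ler_wpM2l// invr_ge0 mulr_ge0// ltW.
  lra.
move: main small Hn; rewrite !ler_norml => /andP[a1 a2] a3 /andP[a4 a5].
by apply/andP; split; lra.
Qed.

Lemma dens_eq n x : I x -> ln ((p n).[x] ^+ 2 * w0 w x) * (p n).[x] ^+ 2 * w x =
  ln (fn w p n x ^+ 2) * fn w p n x ^+ 2 * rho x.
Proof.
move=> Ix; rewrite fn_sqr//; have [x1|x1] := pselect (-1 < x < 1).
  by rewrite -{1}(w0_rho w x1) !mulrA.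
have w00 : w0 w x = 0.
  have := rho_endpoint Ix x1; rewrite /rho /w0 => /eqP; rewrite invr_eq0 => /eqP ->.
  by rewrite mul0r.
by rewrite (rho_endpoint Ix x1) w00 !mulr0 ln0// !mul0r.
Qed.

(** The bound [1 <= M] makes the integrand nonnegative on [Delta]. Its integral there may be
    infinite, but the truncated part is finite, so the difference is never of the form infinity
    minus infinity. *)
Lemma Fn_split (M : R) n : 1 <= M -> Fn w p n = ((- intI (trunc_dens M n))%:E
  - \int[mu]_(x in Delta w p n M) (ln (fn w p n x ^+ 2) * fn w p n x ^+ 2 * rho x)%:E)%E.
Proof.
move=> M1; have M0 : 0 <= M by exact: le_trans M1.
have iT := itg_trunc_dens n M0.
have iS : itg ((fun x => ln (fn w p n x ^+ 2) * fn w p n x ^+ 2 * rho x) \_ (~` Delta w p n M)).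
  by apply: eq_itg iT => x Ix; exact: trunc_dens_restrict.
rewrite /Fn.
have -> : (\int[mu]_(x in I) (ln ((p n).[x] ^+ 2 * w0 w x) * (p n).[x] ^+ 2 * w x)%:E =
   \int[mu]_(x in I) (ln (fn w p n x ^+ 2) * fn w p n x ^+ 2 * rho x)%:E)%E.
  by apply: eq_integral => x /set_mem Ix; rewrite dens_eq.
rewrite (integral_split (measurable_dens n) (measurable_Delta M n))//; first last.
- move=> x [Ix Mf]; rewrite mulr_ge0 ?rho_ge0// mulr_ge0 ?sqr_ge0// ln_ge0//.
  by rewrite -real_normK ?num_real// exprn_ege1// (le_trans M1).
- by move=> x [].
set J := intI (_ \_ _).
have -> : J = intI (trunc_dens M n) by apply: eq_int => x Ix; rewrite trunc_dens_restrict.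
by rewrite [X in (- X)%E = _]addeC fin_num_oppeD// addeC.
Qed.

End entropy_asymptotics.

Theorem theorem2 (R : realType) (w : R -> R) (p : nat -> {poly R})
  (w_meas : measurable_fun (@I11 R) w)
  (w_ge0 : forall x, I11 x -> 0 <= w x)
  (w_int : (@lebesgue_measure R).-integrable (@I11 R) (fun x => (w x)%:E))
  (w_mass : (\int[@lebesgue_measure R]_(x in @I11 R) (w x)%:E = 1%:E)%E)
  (w0_pos : {ae @lebesgue_measure R, forall x, I11 x -> 0 < w0 w x})
  (logw0_int : (@lebesgue_measure R).-integrable (@I11 R)
                 (fun x => (ln (w0 w x) * rho x)%:E))
  (p_on : orthonormal_polys w p) :
  forall M : R, Num.sqrt 2 < M ->
  exists eps : nat -> R, eps @ \oo --> 0 /\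
    \forall n \near \oo,
      Fn w p n =
      ((ln 2 - 1 + eps n)%:E
       - \int[@lebesgue_measure R]_(x in Delta w p n M)
            (ln (fn w p n x ^+ 2) * fn w p n x ^+ 2 * rho x)%:E)%E.
Proof.
move=> M M2.
have wi : itg w by exact: w_int.
have li : itg (fun x => ln (w0 w x) * rho x) by exact: logw0_int.
have M1 : 1 <= M.
  by apply: le_trans (ltW M2); rewrite -[X in X <= _](@sqrtr1 R) ler_wsqrtr// ler1n.
(* The error is the whole deviation of the truncated entropy from its limit, so the identity holds
   for every [n]. *)
exists (fun n => - intI (trunc_dens w p M n) - (ln 2 - 1)); split.
  rewrite -[X in _ --> X](subrr (ln 2 - 1)).
  apply: cvgB; last exact: cvg_cst.
  rewrite -[X in _ --> X]opprK; apply: cvgN; rewrite opprB.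
  exact: (trunc_entropy_cvg w_ge0 wi w0_pos li p_on M2).
apply: nearW => n; rewrite (@Fn_split R w p w_ge0 wi M n M1).
by congr ((_)%:E - _)%E; ring.
Qed.
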